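(* Let $p$ be a prime, let $G$ be a finite group, and let $B$ be a $p$-block of $G$ with defect $d$ and Cartan matrix $C$. If $l(B)\le 4$ and $\det C=p^d$, then \[k(B)\le\frac{p^d-1}{l(B)}+l(B).\] Moreover, this bound is sharp (i.e. there exist blocks $B$ satisfying these hypotheses for which equality holds).
   Context: For a $p$-block $B$ of a finite group $G$, $k(B)$ denotes the number of ordinary irreducible characters in $B$, $l(B)$ the number of irreducible Brauer characters in $B$, and $d$ the defect of $B$ (so a defect group of $B$ has order $p^d$). The Cartan matrix $C\in\mathbb{Z}^{l(B)\times l(B)}$ of $B$ is $C=Q^{\mathrm T}Q$, where $Q$ is the ordinary decomposition matrix of $B$. *)

(* Defs.v *)
From HB Require Import structures.
From mathcomp Require Import all_boot all_order all_algebra all_fingroup.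
From mathcomp Require Import all_solvable all_field all_character.
From mathcomp Require Import finmap.
From mathcomp Require classical_sets cardinality.

Set Implicit Arguments.
Unset Strict Implicit.
Unset Printing Implicit Defensive.

Import GroupScope Order.TTheory GRing.Theory Num.Theory.
Local Open Scope ring_scope.

(* The usual p-modular setup: reduction of the ring Aint of algebraic         *)
(* integers modulo a maximal ideal containing p, with values in an            *)
(* algebraically closed field F of characteristic p. The function is total on *)
(* algC, but it is only used on (and only constrained on) Aint.               *)
Record p_reduction (p : nat) (F : closedFieldType) := PReduction {
  red_fun :> algC -> F;
  red_char : p \in [pchar F];
  red1 : red_fun 1 = 1;
  redD : {in Aint &, {morph red_fun : a b / a + b}};
  redM : {in Aint &, {morph red_fun : a b / a * b}}
}.

Section Blocks.

Variables (p : nat) (F : closedFieldType) (red : p_reduction p F).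
Variables (gT : finGroupType) (G : {group gT}).

(* The group algebra FG is the matrix algebra group_ring F G of the regular   *)
(* representation. A p-block of G is given by its block idempotent e, a       *)
(* primitive idempotent of the center of FG.                                  *)
Definition central_idempotent (e : 'M[F]_(gcard G)) : Prop :=
  (e \in 'Z(group_ring F G))%MS /\ e *m e = e.

Definition block_idempotent (e : 'M[F]_(gcard G)) : Prop :=
  [/\ central_idempotent e, e != 0
    & forall f, central_idempotent f -> f *m e = f -> f = 0 \/ f = e].

(* The central character lambda_chi : Z(FG) -> F of chi = 'chi_i, which maps  *)
(* each class sum K to the reduction of omega_chi(K); gring_proj x z is the   *)
(* coefficient of z at x.                                                     *)
Definition red_central_char (i : Iirr G) (z : 'M[F]_(gcard G)) : F :=
  \sum_(k < #|classes G|)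
    gring_proj (repr (enum_val k)) z 0 0 * red 'omega_i['K_k].

Definition Irr_block (e : 'M[F]_(gcard G)) : {set Iirr G} :=
  [set i | red_central_char i e == 1].

Definition p_regular : {set gT} := [set x in G | p^'.-elt x].

(* Brauer characters are extended by 0 to class functions on G. Since the     *)
(* order m of x is prime to p, each eigenvalue of rG x is the reduction of a  *)
(* unique m-th root of unity; s lists these lifts with multiplicity.          *)
Definition affords_Brauer_char n (rG : mx_representation F G n)
    (phi : 'CF(G)) : Prop :=
  phi \in 'CF(G, p_regular) /\
  forall x, x \in p_regular ->
  exists s : seq algC,
    [/\ all #[x].-unity_root s,
        char_poly (rG x) = \prod_(z <- s) ('X - (red z)%:P)
      & phi x = \sum_(z <- s) z].

Definition is_IBr_block (e : 'M[F]_(gcard G)) (phi : 'CF(G)) : Prop :=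
  exists n (rG : mx_representation F G n),
    [/\ mx_irreducible rG, gring_op rG e = 1%:M & affords_Brauer_char rG phi].

(* The set of irreducible Brauer characters is finite, so this is a           *)
(* duplicate-free enumeration of IBr(B).                                      *)
Definition IBr_block (e : 'M[F]_(gcard G)) : seq 'CF(G) :=
  enum_fset (cardinality.fset_set (is_IBr_block e)).

Definition k_block (e : 'M[F]_(gcard G)) : nat := #|Irr_block e|.
Definition l_block (e : 'M[F]_(gcard G)) : nat := size (IBr_block e).

(* The decomposition numbers of chi are the coordinates on IBr(B) of its      *)
(* restriction to p-regular elements; they are natural numbers.               *)
Definition decomposition_mx (e : 'M[F]_(gcard G)) :
    'M[algC]_(k_block e, l_block e) :=
  \matrix_(i, j) coord (in_tuple (IBr_block e)) j
                       ('1_p_regular * 'chi_(enum_val i))%R.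

Definition Cartan_mx (e : 'M[F]_(gcard G)) : 'M[algC]_(l_block e) :=
  (decomposition_mx e)^T *m decomposition_mx e.

(* z = Tr_D^G(a) for some D-fixed element a of FG, the trace being the sum of *)
(* the conjugates of a by representatives of the right cosets of D in G.      *)
Definition in_rel_trace (D : {group gT}) (z : 'M[F]_(gcard G)) : Prop :=
  let aG := regular_repr F G in
  exists a : 'M[F]_(gcard G),
    [/\ (a \in group_ring F G)%MS,
        forall x, x \in D -> a *m aG x = aG x *m a
      & z = \sum_(Dx in rcosets D G)
              aG (repr Dx)^-1%g *m a *m aG (repr Dx)].

Definition defect_group (e : 'M[F]_(gcard G)) (D : {group gT}) : Prop :=
  [/\ D \subset G, in_rel_trace D e
    & forall H : {group gT}, H \subset D -> in_rel_trace H e -> H :=: D].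

Definition has_defect (e : 'M[F]_(gcard G)) (d : nat) : Prop :=
  exists2 D : {group gT}, defect_group e D & #|D| = (p ^ d)%N.

End Blocks.

(* Main.v *)
(* Let Q be the decomposition matrix of B, with k rows and l columns.         *)
(* By the Cauchy-Binet formula det C = det (Q^T Q) is at least the number of  *)
(* l-subsets of the rows of Q that are bases. Fix one basis and join a basis  *)
(* row s to a non-basis row t when the coordinate of t at s is nonzero. If    *)
(* this bipartite graph is connected, exchanging rows along a shortest path   *)
(* from s to t yields another basis, from which the path, hence s and t, can  *)
(* be recovered: there are at least l (k - l) + 1 bases, and this is the      *)
(* required bound. Otherwise Irr(B) splits into nonempty parts J and J' whose *)
(* rows span independent spaces. Block orthogonality then shows that          *)
(* sum_(chi in J) d_(chi, phi) chi vanishes on p-singular elements for all    *)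
(* phi in IBr(B), so the coefficients of sum_(chi in J) e_chi are p-integral, *)
(* and its reduction is a central idempotent of FG which contradicts the      *)
(* primitivity of the block idempotent. The trivial group gives equality.     *)

Require Import Defs.
From HB Require Import structures.
From mathcomp Require Import all_boot all_order all_algebra all_fingroup.
From mathcomp Require Import all_solvable all_field all_character.
From mathcomp Require Import finmap boolp ring.
From mathcomp Require classical_sets cardinality.

Set Implicit Arguments.
Unset Strict Implicit.
Unset Printing Implicit Defensive.

Import GroupScope Order.TTheory GRing.Theory Num.Theory.
Local Open Scope ring_scope.

(** * Bases of the row space of an integer matrix *)

(** With k = k(B) and l = l(B), the heart of the matter is the determinant bound l (k - l) + 1 <=
    det C ([block_det_Cartan_ge]); substituting det C = p^d and solving for k gives the inequality.

    The combinatorial half is [connected_gram_det_ge]. By Cauchy-Binet, det (Q^T Q) is the sum of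
    the squared maximal minors of the integer matrix Q, so it is at least the number of row bases.
    Besides a fixed basis S0, each pair of a row s in S0 and a row t outside yields a basis of its
    own, by exchanging rows along a chordless path from s to t: [exchange_along_path] proves that it
    is a basis, and [induced_path_ends] recovers the pair from it.

    The block-theoretic half shows that such paths exist. A disconnected graph would give a matrix E
    that fixes the rows of Q in a proper nonempty set J and kills the others. Applying E to
    [block_orthogonality] makes the sums over J of d_(chi, phi) chi vanish on p-singular elements,
    hence |G|_p divides their degrees and the sum of e_chi over J is p-integral. Its reduction
    splits the block idempotent, a contradiction ([block_part_trivial]). The modular theory needed
    for this rests on the valuation ring [vring], the reduction of ordinary representations
    ([irr_reduction]) and the independence of Brauer characters ([IBr_free]).

    Sharpness is witnessed by the trivial group, over a reduction provided by
    [p_reduction_exists]. *)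

Lemma Cauchy_Binet_Gram (R : comNzRingType) k l (A : 'M[R]_(k, l)) :
  (l`!)%:R * \det (A^T *m A)
    = \sum_(f : {ffun 'I_l -> 'I_k}) \det (rowsub f A) ^+ 2.
Proof.
(* Expand each entry of A^T A and distribute. Summing over all maps f, not over subsets, avoids
   orderings: non-injective maps contribute 0 and each l-subset is counted l! times. *)
have detE: \det (A^T *m A) = \sum_(f : {ffun 'I_l -> 'I_k})
    (\prod_i A (f i) i) * \det (rowsub f A).
  under [RHS]eq_bigr do rewrite mulr_sumr.
  rewrite exchange_big /=; apply: eq_bigr => s _.
  under [RHS]eq_bigr => f _ do rewrite mulrCA -big_split /=.
  rewrite -mulr_sumr; congr (_ * _).
  under eq_bigr do rewrite mxE; rewrite bigA_distr_bigA /=.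
  by apply: eq_bigr => f _; apply: eq_bigr => i _; rewrite !mxE.
(* Composing f with t permutes the rows of the minor and costs the sign of t; summing over the l!
   permutations t rebuilds the second copy of the minor. *)
have detP (t : 'S_l) : \det (A^T *m A) = \sum_(f : {ffun 'I_l -> 'I_k})
    \det (rowsub f A) * ((-1) ^+ t * \prod_i (rowsub f A)^T i (t i)).
  rewrite detE (reindex_inj (h := fun f : {ffun 'I_l -> 'I_k} => [ffun i => f
    (t i)])) /=; last first.
    move=> f g /ffunP fg; apply/ffunP => i.
    by have := fg (t^-1%g i); rewrite !ffunE permKV.
  apply: eq_bigr => f _; rewrite [LHS]mulrC.
  have ->: rowsub [ffun i => f (t i)] A = row_perm t (rowsub f A).
    by apply/matrixP=> i j; rewrite !mxE ffunE.
  rewrite row_permE det_mulmx det_perm -mulrA [RHS]mulrCA; congr (_ * (_ * _)).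
  by apply: eq_bigr => i _; rewrite !mxE ffunE.
rewrite mulr_natl -[l`!]card_Sn -sumr_const.
under eq_bigr => t _ do rewrite (detP t).
rewrite exchange_big /=; apply: eq_bigr => f _.
rewrite -mulr_sumr expr2 -[X in _ = _ * X]det_tr; congr (_ * _).
Qed.

(** * Chordless paths in a graph *)

Definition induced_path (T : finType) (e : rel T) (q : seq T) :=
  uniq q /\ forall x0 i j, (i < size q)%N -> (j < size q)%N ->
    e (nth x0 q i) (nth x0 q j) = (i == j.+1) || (j == i.+1).

(** A path of least length works: a chord or a repeated vertex would allow a shortcut. *)
Lemma connect_induced_path (T : finType) (e : rel T) x y :
  symmetric e -> irreflexive e -> connect e x y ->
  exists2 p, induced_path e (x :: p) & last x p = y.
Proof.
move=> eC eI /connectP[p0 ep0 yE].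
have exP: exists n, [exists p : n.-tuple T, path e x p && (last x p == y)].
  exists (size p0); apply/existsP; exists (in_tuple p0).
  by rewrite ep0 yE eqxx.
have [n /existsP[p /andP[ep /eqP lp]] minn] := ex_minnP exP.
have sz := size_tuple p; exists p => //.
have min p' : path e x p' -> last x p' = y -> (n <= size p')%N.
  move=> ep' lp'; apply: minn; apply/existsP; exists (in_tuple p').
  by rewrite ep' lp' eqxx.
have adj x0 i : (i < n)%N -> e (nth x0 (x :: p) i) (nth x0 (x :: p) i.+1).
  by move=> ltin; move/pathP: ep; apply; rewrite sz.
have cut x0 i j : (i <= j < n)%N ->
    e (nth x0 (x :: p) i) (nth x0 (x :: p) j.+1) -> i = j.
  move=> /andP[leij ltj] eij; apply/eqP; rewrite eqn_leq leij /=.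
  pose p' := take i p ++ drop j p.
  have lti : (i < n)%N by apply: leq_ltn_trans ltj.
  have lasti: last x (take i p) = nth x0 (x :: p) i.
    case: i {leij eij p'} lti => [|i] lti; first by rewrite take0.
    by rewrite (take_nth x0) ?sz ?last_rcons // ltnW.
  have: (n <= size p')%N.
    apply: min; last first.
      have: last x (take j p ++ drop j p) = y by rewrite cat_take_drop.
      by rewrite /p' !last_cat (drop_nth x0) ?sz.
    rewrite cat_path lasti (drop_nth x0) ?sz //= eij.
    have := ep; rewrite -{1}(cat_take_drop i p) cat_path => /andP[-> _] /=.
    by have := ep; rewrite -{1}(cat_take_drop j.+1 p) cat_path (take_nth x0)
      ?sz // last_rcons => /andP[_ ->].
  rewrite size_cat size_drop size_takel sz ?(ltnW lti) //.
  by move=> h; rewrite -(leq_add2r (n - j)) subnKC // ltnW.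
have nth_lt x0 i j : (i < j <= n)%N ->
    e (nth x0 (x :: p) i) (nth x0 (x :: p) j) = (j == i.+1).
  case/andP=> ltij lej; apply/idP/eqP => [eij|jE]; last first.
    by move: lej; rewrite jE; apply: adj.
  case: j ltij lej eij => // j; rewrite ltnS => leij ltj eij.
  by rewrite (cut x0 i j _ eij) ?leij.
have symE x0 i j : (i < n.+1)%N -> (j < n.+1)%N ->
    e (nth x0 (x :: p) i) (nth x0 (x :: p) j) = (i == j.+1) || (j == i.+1).
  rewrite !ltnS => lei lej; have [ltij|ltji|->] := ltngtP i j.
  - by rewrite nth_lt ?ltij // [i == _]ltn_eqF // ltnS ltnW.
  - by rewrite eC nth_lt ?ltji // [j == _]ltn_eqF ?orbF // ltnS ltnW.
  by rewrite eI eqn_leq ltnn andbF.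
split; last by move=> x0 i j; rewrite /= sz; apply: symE.
suff min_uniq: ~~ uniq (x :: p) -> False by apply: contraT => /min_uniq.
move: lp (min) ; case/shortenP: ep => p' ep' up' sub lp min' nu.
have:= min' _ ep' lp; rewrite -sz => le.
have: uniq (x :: p) by apply: leq_size_uniq up' _ _ => // z; rewrite !inE;
  case: (z == x) => //=; exact: sub.
by rewrite (negPf nu).
Qed.

(** * The fundamental graph of a basis and exchange along its paths *)

Section FundamentalGraph.

Variables (F : fieldType) (k l : nat) (Q : 'M[F]_(k, l)) (f0 : 'I_l -> 'I_k).
Hypothesis uP : rowsub f0 Q \in unitmx.

Let A := Q *m invmx (rowsub f0 Q).
Let S0 : {set 'I_k} := [set f0 u | u : 'I_l].

Lemma fundamental_mx_id u w : A (f0 u) w = (u == w)%:R.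
Proof.
have: rowsub f0 A = 1%:M by rewrite -mul_rowsub_mx mulmxV.
by move/matrixP/(_ u w); rewrite !mxE.
Qed.

Lemma basis_fun_inj : injective f0.
Proof.
move=> u w /(congr1 (fun x => A x w)); rewrite !fundamental_mx_id eqxx.
by have [//|_ /eqP] := eqVneq u w; rewrite eq_sym oner_eq0.
Qed.

(** The fundamental graph of the basis [f0] in the matroid of rows of [Q]; it is bipartite between
    [S0] and its complement. *)
Definition fundamental_edge x y :=
  [exists u, ((f0 u == x) && (A y u != 0) && (y \notin S0))
          || ((f0 u == y) && (A x u != 0) && (x \notin S0))].
Local Notation e := fundamental_edge.

Lemma fundamental_edge_sym : symmetric e.
Proof. by move=> x y; apply: eq_existsb => u; rewrite orbC. Qed.

Lemma fundamental_edgeE u y : y \notin S0 -> e (f0 u) y = (A y u != 0).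
Proof.
move=> S'y; apply/existsP/idP => [[w]|nz]; last by exists u; rewrite eqxx nz
  S'y.
rewrite (imset_f f0) // andbF orbF => /andP[/andP[/eqP/basis_fun_inj ->]] //.
Qed.

Lemma fundamental_edge_side x y : e x y -> (x \in S0) = (y \notin S0).
Proof.
by case/existsP=> u /orP[] /andP[/andP[/eqP <- _]] /negPf H; rewrite H imset_f.
Qed.

Lemma fundamental_edge_irr : irreflexive e.
Proof.
move=> x; have [exx|/negPf//] := boolP (e x x); have := fundamental_edge_side
  exx.
by case: (x \in S0).
Qed.

(** Each basis row on the path is replaced by its successor, which exists because the path ends
    outside [S0]. Since the path has no chords, among the basis rows on it a successor involves only
    its predecessor and the next basis row, so the new rows have triangular coordinates with nonzero
    diagonal. Rows off the path are unchanged. *)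
Lemma exchange_along_path u p (t := last (f0 u) p) :
    t \notin S0 -> induced_path e (f0 u :: p) ->
  exists2 f : 'I_l -> 'I_k, rowsub f Q \in unitmx &
    forall v, (v \in f0 u :: p) = (v \in S0) (+) (v \in [set f w | w : 'I_l]).
Proof.
set q := f0 u :: p => S't [uq adj].
pose f w := if f0 w \in q then nth t q (index (f0 w) q).+1 else f0 w.
have lastE : nth t q (size q).-1 = t by rewrite nth_last.
have lt_idx w : f0 w \in q -> ((index (f0 w) q).+1 < size q)%N.
  move=> qw; rewrite ltn_neqAle index_mem qw andbT; apply: contra S't => /eqP
    sE.
  by rewrite -lastE -sE /= nth_index // imset_f.
have edge_next w : f0 w \in q -> e (f0 w) (f w).
  move=> qw; rewrite /f qw -{1}(nth_index t qw) adj ?index_mem ?lt_idx //.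
  by rewrite eqxx orbT.
have f_out w : f0 w \in q -> f w \notin S0.
  by move=> /edge_next /fundamental_edge_side <-; rewrite imset_f.
exists f.
  have -> : rowsub f Q = rowsub f A *m rowsub f0 Q.
    by rewrite mul_rowsub_mx /A mulmxKV.
  rewrite unitmx_mul uP andbT -unitmx_tr -row_free_unit -kermx_eq0.
  apply/eqP/row_matrixP => i; rewrite row0; set x := row i _.
  have xA w : \sum_v x 0 v * A (f w) v = 0.
    have: x *m (rowsub f A)^T = 0 by apply/sub_kermxP; rewrite row_sub.
    move/rowP/(_ w) => xE; apply: etrans (etrans xE _); last by rewrite mxE.
    by rewrite mxE; apply: eq_bigr => v _; congr (_ * _); rewrite !mxE.
  have x_off w : f0 w \notin q -> x 0 w = 0.
    move=> q'w; have:= xA w; rewrite /f (negPf q'w) (bigD1 w) //=.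
    rewrite fundamental_mx_id eqxx mulr1 big1 ?addr0 // => v /negPf nvw.
    by rewrite fundamental_mx_id eq_sym nvw mulr0.
  (* Here [m] bounds the distance to the end of the path: the kernel vector is killed backwards from
     the last basis row, as the equation at [f w] involves only [w] and the next basis row, already
     treated. *)
  have x_on m w : f0 w \in q -> (size q - index (f0 w) q <= m)%N -> x 0 w = 0.
    elim: m w => [|m IHm] w qw.
      by rewrite leqn0 subn_eq0 leqNgt index_mem qw.
    move=> le_m; have:= xA w; rewrite (bigD1 w) //= big1 => [|v nvw].
      rewrite addr0 => /eqP; rewrite mulf_eq0 => /orP[/eqP // | Aw0].
      by have:= edge_next w qw; rewrite fundamental_edgeE ?f_out // Aw0.
    have [->|nzA] := eqVneq (A (f w) v) 0; first by rewrite mulr0.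
    have [qv|q'v] := boolP (f0 v \in q); last by rewrite x_off ?mul0r.
    rewrite -fundamental_edgeE ?f_out // in nzA.
    move: nzA; rewrite /f qw -{1}(nth_index t qv) adj ?index_mem ?lt_idx //.
    rewrite eqSS => /orP[/eqP iE | /eqP iE].
      rewrite IHm ?mul0r // iE.
      by rewrite leq_subLR in le_m; rewrite leq_subLR (leq_trans le_m) //
        !addSn addnS.
    case/eqP: nvw; apply: basis_fun_inj.
    by rewrite -(nth_index t qv) -(nth_index t qw) iE.
  apply/rowP=> w; rewrite [RHS]mxE.
  by have [qw|/x_off//] := boolP (f0 w \in q); apply: x_on (leqnn _).
move=> v; have [Sv|S'v] := boolP (v \in S0).
  case/imsetP: (Sv) => w _ vE; rewrite {v}vE in Sv *.
  rewrite addTb; apply/idP/negP => [qw /imsetP[w' _ fE]|nf].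
    move: (fE); rewrite /f; case: ifP => [qw'|/negbT q'w']; last first.
      by move=> E; move: q'w'; rewrite -E qw.
    by move=> _; move: (f_out w' qw'); rewrite -fE Sv.
  by apply/negPn/negP => q'w; apply/nf/imsetP; exists w; rewrite // /f (negPf
    q'w).
rewrite addFb; apply/idP/imsetP => [qv|[w _ fE]].
  have: (0 < index v q)%N.
    rewrite lt0n; apply: contra S'v => /eqP iE.
    by rewrite -(nth_index t qv) iE imset_f.
  case iE: (index v q) => [//|i] _.
  have lti : (i.+1 < size q)%N by rewrite -iE index_mem.
  have: e (nth t q i) v.
    by rewrite -(nth_index t qv) iE adj ?eqxx ?orbT // ltnW.
  move/fundamental_edge_side; rewrite S'v => /imsetP[w _ wE]; exists w => //.
  have qw: f0 w \in q by rewrite -wE mem_nth // ltnW.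
  by rewrite /f qw -wE index_uniq // 1?ltnW // -iE nth_index.
rewrite fE; move: S'v; rewrite fE /f.
by case: ifP => [qw _|_]; [rewrite mem_nth ?lt_idx | rewrite imset_f].
Qed.

(** The ends of an induced path are the vertices with at most one neighbour in the path, which
    depends on its vertex set only; the bipartition tells the start from the end. *)
Lemma induced_path_ends u p u' p' :
    last (f0 u) p \notin S0 -> last (f0 u') p' \notin S0 ->
    induced_path e (f0 u :: p) -> induced_path e (f0 u' :: p') ->
    f0 u :: p =i f0 u' :: p' ->
  u = u' /\ last (f0 u) p = last (f0 u') p'.
Proof.
set q := f0 u :: p; set q' := f0 u' :: p'; set t := last _ p; set t' := last _
  p'.
move=> S't S't' [uq adj] [uq' adj'] eq_q.
have deg1 v : v \in q -> (index v q == 0%N) || (index v q == size p) ->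
    {in q &, forall a b, e v a -> e v b -> a = b}.
  move=> qv vE a b qa qb.
  rewrite -(nth_index t qv) -(nth_index t qa) -(nth_index t qb) !adj ?index_mem
    //.
  move: vE => /orP[] /eqP -> ; first by move=> /eqP-> /eqP->.
  have ge c : c \in q -> (index c q == (size p).+1) = false.
    by move=> qc; rewrite ltn_eqF // -[(size p).+1]/(size q) index_mem.
  by rewrite !ge // !orbF => /eqP-> ; rewrite eqSS => /eqP ->.
have deg2 v : v \in q' -> (0 < index v q' < size p')%N ->
    ~ {in q' &, forall a b, e v a -> e v b -> a = b}.
  move=> qv; case iE: (index v q') => [|i] //= lti uniqv.
  have szq: size q' = (size p').+1 by [].
  have: nth t q' i = nth t q' i.+2.
    apply: uniqv; rewrite ?mem_nth ?szq ?ltnS // 1?ltnW // 1?ltnW //.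
      by rewrite -(nth_index t qv) iE adj' ?szq ?ltnS ?eqxx // ltnW // ltnW.
    by rewrite -(nth_index t qv) iE adj' ?szq ?ltnS ?eqxx ?orbT // ltnW.
  move/eqP; rewrite nth_uniq ?szq ?ltnS // 1?ltnW // 1?ltnW //.
  by rewrite ltn_eqF.
have tE : t = nth t q (size p) by rewrite -[size p]/(size q).-1 nth_last.
have t'E : t' = nth t q' (size p') by rewrite -[size p']/(size q').-1 nth_last.
have ends v : v \in q -> (index v q == 0%N) || (index v q == size p) ->
    v = f0 u' \/ v = t'.
  move=> qv vE; have qv' : v \in q' by rewrite -eq_q.
  have {vE} := deg1 v qv vE.
  have [iE _|gt0] := posnP (index v q').
    by left; rewrite -(nth_index t qv') iE.
  have [lti|ge] := ltnP (index v q') (size p').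
    move=> dv; case: (deg2 v qv'); first by rewrite gt0.
    by move=> a b; rewrite -!eq_q; apply: dv.
  right; rewrite -(nth_index t qv') t'E; congr (nth _ _ _).
  by apply/eqP; rewrite eqn_leq ge andbT -ltnS -[(size p').+1]/(size q')
    index_mem.
have Sf w : f0 w \in S0 by rewrite imset_f.
split.
  have [||/basis_fun_inj //|uE] := ends (f0 u); rewrite ?mem_head //= ?eqxx //.
  by move: S't'; rewrite -uE Sf.
have [||tu|//] := ends t; first by rewrite mem_last.
  have ->: index t q = size p by rewrite {1}tE index_uniq.
  by rewrite eqxx orbT.
by move: S't; rewrite tu Sf.
Qed.

End FundamentalGraph.

(** The fibre of any image contains the l! distinct rearrangements of one member. *)
Lemma card_fun_by_image l k (D : {set {ffun 'I_l -> 'I_k}}) :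
    (forall f : {ffun 'I_l -> 'I_k}, f \in D -> injective f) ->
    (forall f (s : 'S_l), f \in D -> [ffun i => f (s i)] \in D) ->
  (l`! * #|[set f @: 'I_l | f : {ffun 'I_l -> 'I_k} in D]| <= #|D|)%N.
Proof.
move=> injD permD; set I := [set _ | _ in _].
rewrite -[#|D|]sum1_card (partition_big (fun f : {ffun _} => f @: 'I_l) (mem
  I)) /=; last first.
  by move=> f Df; apply: imset_f.
rewrite mulnC -sum_nat_const; apply: leq_sum => S /imsetP[f Df ->].
rewrite sum1_card -card_Sn -(card_imset (f := fun s : 'S_l => [ffun i => f (s
  i)])).
  apply/subset_leq_card/subsetP => _ /imsetP[s _ ->].
  rewrite unfold_in /= permD //=; apply/eqP/setP=> x.
  apply/imsetP/imsetP => -[i _ ->]; first by rewrite ffunE; exists (s i).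
  by exists (s^-1%g i); rewrite ?ffunE ?permKV.
move=> s t /ffunP st; apply/permP=> i; apply: (injD f Df).
by have:= st i; rewrite !ffunE.
Qed.

(** The condition on [J] and [E] states connectedness without choosing a basis: the rows cannot be
    split into two nonempty parts with independent spans. The final + 1 counts the initial basis
    itself. *)
Theorem connected_gram_det_ge (R : archiNumFieldType) k l (Q : 'M[R]_(k, l)) :
    (forall i j, Q i j \is a Num.int) ->
    \det (Q^T *m Q) != 0 ->
    (forall (J : {set 'I_k}) (E : 'M_l),
       {in J, forall i, row i Q *m E = row i Q} ->
       {in ~: J, forall i, row i Q *m E = 0} -> J = set0 \/ J = setT) ->
  (l * (k - l)).+1%:R <= \det (Q^T *m Q).
Proof.
move=> intQ nz_det connQ.
have lfact : (l`!)%:R != 0 :> R by rewrite pnatr_eq0 -lt0n fact_gt0.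
pose D := [set f : {ffun 'I_l -> 'I_k} | \det (rowsub f Q) != 0].
pose I := [set f @: 'I_l | f : {ffun 'I_l -> 'I_k} in D].
have int_det (f : {ffun 'I_l -> 'I_k}) : \det (rowsub f Q) \is a Num.int.
  apply: rpred_sum => s _; rewrite rpredMsign rpred_prod // => i _.
  by rewrite !mxE intQ.
have det_ge : #|D|%:R <= (l`!)%:R * \det (Q^T *m Q).
  rewrite Cauchy_Binet_Gram -sum1_card natr_sum big_mkcond /=.
  apply: ler_sum => f _; rewrite inE; case: ifPn => [nzf|_].
    by rewrite -intr_normK ?int_det // exprn_ege1 // norm_intr_ge1.
  by rewrite -intr_normK ?int_det // exprn_ge0.
have injD (f : {ffun 'I_l -> 'I_k}) : f \in D -> injective f.
  by rewrite inE -unitfE -unitmxE => /basis_fun_inj.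
have permD f (s : 'S_l) : f \in D -> [ffun i => f (s i)] \in D.
  rewrite !inE; have ->: rowsub [ffun i => f (s i)] Q = row_perm s (rowsub f Q).
    by apply/matrixP => i j; rewrite !mxE ffunE.
  by rewrite row_permE det_mulmx det_perm mulf_eq0 negb_or signr_eq0.
suff card_I : ((l * (k - l)).+1 <= #|I|)%N.
  rewrite -(ler_pM2l (x := (l`!)%:R)) ?ltr0n ?fact_gt0 //.
  apply: le_trans det_ge; rewrite -natrM ler_nat.
  by apply: leq_trans (card_fun_by_image injD permD); rewrite leq_mul2l card_I
    orbT.
have [f0 Df0]: exists f, f \in D.
  apply/set0Pn; apply: contraNneq nz_det => D0.
  rewrite -(mulrI_eq0 _ (mulfI lfact)) Cauchy_Binet_Gram big1 // => f _.
  by have /setP/(_ f) := D0; rewrite !inE => /negbFE/eqP ->; rewrite expr0n.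
have uP : rowsub f0 Q \in unitmx by move: Df0; rewrite inE -unitfE -unitmxE.
pose S0 := [set f0 u | u : 'I_l].
pose e := fundamental_edge Q f0.
have eC : symmetric e by exact: fundamental_edge_sym.
have conn x y : connect e x y.
  (* [J] is the component of [x], and [invmx P *m diag_mx d *m P] projects onto the span of the
     basis rows in [J] along the other basis rows. It respects the partition because a nonzero
     coordinate of a non-basis row is an edge. *)
  pose J := [set y | connect e x y]; pose P := rowsub f0 Q.
  pose d := \row_(u < l) (f0 u \in J)%:R : 'rV[R]_l.
  pose A := Q *m invmx P.
  have QA : Q = A *m P by rewrite mulmxKV.
  have rowE i : row i Q *m (invmx P *m diag_mx d *m P)
              = \row_u (A i u * (f0 u \in J)%:R) *m P.
    rewrite !mulmxA -row_mul -/A; congr (_ *m _).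
    by rewrite mul_mx_diag; apply/rowP => u; rewrite !mxE.
  have same i u : A i u != 0 -> (f0 u \in J) = (i \in J).
    move=> nz; have [/imsetP[w _ iE]|S'i] := boolP (i \in S0).
      move: nz; rewrite iE fundamental_mx_id //.
      by have [->|] := eqVneq w u; rewrite ?eqxx.
    have eui: e (f0 u) i by rewrite /e fundamental_edgeE.
    rewrite !inE; apply: (same_connect_r (sym_connect_sym eC) (connect1 eui)).
  have [||J0|JT] := connQ J (invmx P *m diag_mx d *m P).
  - move=> i Ji; rewrite rowE [in RHS]QA row_mul; congr (_ *m _).
    apply/rowP=> u; rewrite [LHS]mxE [RHS]mxE; have [->|nz] := eqVneq (A i u)
      0; first by rewrite mul0r.
    by rewrite (same i u nz) Ji mulr1.
  - move=> i; rewrite inE => J'i; rewrite rowE; apply/eqP.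
    rewrite -[X in _ == X](mul0mx _ P); apply/eqP; congr (_ *m _).
    apply/rowP=> u; rewrite [LHS]mxE [RHS]mxE; have [->|nz] := eqVneq (A i u)
      0; first by rewrite mul0r.
    by rewrite (same i u nz) (negPf J'i) mulr0.
  - by have: x \in J; [rewrite inE connect0 | rewrite J0 inE].
  have: y \in J by rewrite JT inE.
  by rewrite inE.
(* Stated for all pairs so that a choice function exists on the whole finite type; for [t] in [S0]
   the value [set0] is a dummy. *)
have exB (ut : 'I_l * 'I_k) : exists B : {set 'I_k}, ut.2 \notin S0 ->
    B \in I /\ exists p, [/\ last (f0 ut.1) p = ut.2, induced_path e (f0 ut.1
      :: p)
      & forall v, (v \in f0 ut.1 :: p) = (v \in S0) (+) (v \in B)].
  case: ut => u t /=; have [St|S't] := boolP (t \in S0); first by exists set0.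
  have [p pP lp] := connect_induced_path eC (fundamental_edge_irr Q f0) (conn
    (f0 u) t).
  have [|f uf fE] := exchange_along_path uP _ pP; first by rewrite lp.
  exists [set f w | w : 'I_l] => _; split; last by exists p.
  apply/imsetP; exists [ffun w => f w]; last first.
    by apply: eq_imset => w; rewrite ffunE.
  rewrite inE -unitfE -unitmxE; congr (_ \in unitmx): uf.
  by apply/matrixP => i j; rewrite !mxE ffunE.
have [B BP] := fin_all_exists exB.
have BE u t : t \notin S0 -> B (u, t) \in I /\ exists p, [/\ last (f0 u) p = t,
    induced_path e (f0 u :: p)
      & forall v, (v \in f0 u :: p) = (v \in S0) (+) (v \in B (u, t))].
  by move=> S't; apply: (BP (u, t)).
have cardS0 : #|S0| = l by rewrite card_imset ?card_ord //; apply: injD.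
have cardX : (l * (k - l) = #|setX [set: 'I_l] (~: S0)|)%N.
  by rewrite cardsX cardsT card_ord cardsCs setCK cardS0 card_ord.
have injB : {in setX [set: 'I_l] (~: S0) &, injective B}.
  move=> [u t] [u' t']; rewrite !inE /= => S't S't' eqB.
  have [_ [p [lp pP pE]]] := BE u t S't.
  have [_ [p' [lp' pP' pE']]] := BE u' t' S't'.
  have t_out: last (f0 u) p \notin S0 by rewrite lp.
  have t_out': last (f0 u') p' \notin S0 by rewrite lp'.
  have eq_q: f0 u :: p =i f0 u' :: p' by move=> v; rewrite pE pE' eqB.
  have [uu' tt'] := induced_path_ends uP t_out t_out' pP pP' eq_q.
  by rewrite -uu' -lp -lp' tt'.
rewrite cardX -(card_in_imset injB) -[X in (X <= _)%N]add1n.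
(* The symmetric difference of [S0] with an exchanged basis contains the end [t] of its path, so it
   is not empty. *)
have S0notin : S0 \notin B @: setX [set: 'I_l] (~: S0).
  apply/negP=> /imsetP[[u t]]; rewrite !inE /= => S't S0E.
  have [_ [p [lp _ /(_ t)]]] := BE u t S't.
  by rewrite -S0E addbb -lp mem_last.
rewrite -[1%N]/(true : nat) -S0notin -cardsU1; apply/subset_leq_card/subsetP =>
  S.
rewrite !inE => /predU1P[->|/imsetP[[u t]]]; first by apply: imset_f.
by rewrite !inE /= => S't ->; case: (BE u t S't).
Qed.

(** * The localization of Aint at the kernel of the reduction *)

(** Transitivity of integral dependence. *)
Lemma root_monic_over_Aint (q : {poly algC}) x :
  root q x -> q \is monic -> q \is a polyOver Aint -> x \in Aint.
Proof.
move=> qx0 mon_q /polyOverP Aq.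
have intA y : y \in Aint -> integralOver (intr : int -> algC) y.
  rewrite unfold_in => /floorpP[r Dr]; exists r; last by rewrite -Dr
    root_minCpoly.
  apply/monicP/(@intr_inj algC); rewrite -[LHS]lead_coef_map_inj ?rmorph0 -?Dr
    //; last exact: intr_inj.
  exact/monicP/minCpoly_monic.
have [r mon_r rx0] : integralOver (intr : int -> algC) x.
  apply: (integral_root_monic mon_q qx0) => _ /(nthP 0)[i _ <-]; exact: intA.
apply: (root_monic_Aint rx0); first exact: monic_map.
by apply/polyOverP => i; rewrite coef_map /= intr_int.
Qed.

(** If q has degree n + 1 and leading coefficient a, then a^n q(X) = r(a X) with the monic integral
    polynomial [r] below. *)
Lemma Aint_lead_coefM (q : {poly algC}) x :
  q \is a polyOver Aint -> root q x -> (1 < size q)%N -> lead_coef q * x \in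
    Aint.
Proof.
move=> /polyOverP Aq qx0; case sq: (size q) => [|[|n]] // _.
set a := lead_coef q; have Aa : a \in Aint by apply: Aq.
have nz_a : a != 0 by rewrite lead_coef_eq0 -size_poly_eq0 sq.
pose c i := if i == n.+1 then 1 else q`_i * a ^+ (n - i).
pose r := \poly_(i < n.+2) c i.
have cn : c n.+1 = 1 by rewrite /c eqxx.
have size_r : size r = n.+2 by rewrite size_poly_eq // cn oner_eq0.
apply: (@root_monic_over_Aint r).
- apply/rootP; rewrite horner_poly; apply: (mulfI nz_a); rewrite mulr0.
  have := rootP qx0; rewrite horner_coef sq => /(congr1 ( *%R (a ^+ n.+1))).
  rewrite mulr0 => E; rewrite -[RHS]E !mulr_sumr; apply: eq_bigr => i _.
  rewrite /c exprMn; case: eqP => [->|/eqP nei].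
    have -> : q`_n.+1 = a by rewrite /a lead_coefE sq.
    by rewrite mul1r mulrCA.
  have lei : (i <= n)%N by rewrite -ltnS ltn_neqAle nei -ltnS ltn_ord.
  have ->: a ^+ n.+1 = a * a ^+ (n - i) * a ^+ i by rewrite -exprS -exprD addSn
    subnK.
  by ring.
- by apply/monicP; rewrite lead_coefE size_r coef_poly ltnSn cn.
apply/polyOver_poly => i _; rewrite /c; case: eqP => // _.
by rewrite rpredM ?rpredX.
Qed.

Section Reduction.

Variables (p : nat) (F : closedFieldType) (red : p_reduction p F).

Lemma red0 : red 0 = 0.
Proof. by apply: (addrI (red 0)); rewrite addr0 -redD ?addr0. Qed.

Lemma redN : {in Aint, {morph red : a / - a}}.
Proof.
by move=> a Aa; apply: (addrI (red a)); rewrite -redD ?rpredN // !subrr red0.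
Qed.

Lemma redB : {in Aint &, {morph red : a b / a - b}}.
Proof. by move=> a b Aa Ab; rewrite redD ?rpredN // redN. Qed.

Lemma red_nat n : red n%:R = n%:R.
Proof.
elim: n => [|n IHn]; first exact: red0.
by rewrite !mulrS redD ?rpred_nat ?IHn ?red1.
Qed.

Lemma red_int (m : int) : red m%:~R = m%:~R.
Proof.
case: m => n; first exact: red_nat.
by rewrite NegzE !mulrNz redN ?rpred_nat //= -!pmulrn red_nat.
Qed.

(** The fractions of algebraic integers whose denominator does not reduce to 0. By [vring_total]
    this is a valuation ring of [algC], so no number field has to be fixed. *)
Definition vring_pred : {pred algC} := fun x =>
  `[< exists a b, [/\ a \in Aint, b \in Aint, red b != 0 & x = a / b] >].

Lemma vringP x : reflect
  (exists a b, [/\ a \in Aint, b \in Aint, red b != 0 & x = a / b])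
  (x \in vring_pred).
Proof. exact: asboolP. Qed.

Lemma red_neq0 b : red b != 0 -> b != 0.
Proof. by apply: contraNneq => ->; rewrite red0. Qed.

Lemma Aint_vring : {subset Aint <= vring_pred}.
Proof.
move=> a Aa; apply/vringP; exists a, 1.
by rewrite Aint1 red1 oner_eq0 divr1.
Qed.

Lemma vring_subring_closed : subring_closed vring_pred.
Proof.
split=> [|x y|x y]; first exact: Aint_vring.
  move=> /vringP[a [b [Aa Ab nzb ->]]] /vringP[c [d [Ac Ad nzd ->]]].
  apply/vringP; exists (a * d - c * b), (b * d).
  rewrite !(rpredB, rpredM) // redM // mulf_neq0 //; split=> //.
  by rewrite mulrBl -mulf_div divff ?red_neq0 // mulr1 [b * d]mulrC -mulf_div
    divff ?red_neq0 // mulr1.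
move=> /vringP[a [b [Aa Ab nzb ->]]] /vringP[c [d [Ac Ad nzd ->]]].
apply/vringP; exists (a * c), (b * d).
by rewrite !rpredM // redM // mulf_neq0 // mulf_div.
Qed.

HB.instance Definition _ :=
  GRing.isSubringClosed.Build algC vring_pred vring_subring_closed.

Definition vring := {x : algC | x \in vring_pred}.
HB.instance Definition _ := SubType.on vring.
HB.instance Definition _ := Choice.on vring.
HB.instance Definition _ := [SubChoice_isSubComNzRing of vring by <:].

Definition vval (x : vring) : algC := val x.

Lemma vval_inj : injective vval. Proof. exact: val_inj. Qed.

Fact vval_is_zmod_morphism : zmod_morphism vval. Proof. exact: rmorphB. Qed.

Fact vval_is_monoid_morphism : monoid_morphism vval.
Proof. by split; [apply: rmorph1 | apply: rmorphM]. Qed.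

HB.instance Definition _ :=
  GRing.isZmodMorphism.Build vring algC vval vval_is_zmod_morphism.
HB.instance Definition _ :=
  GRing.isMonoidMorphism.Build vring algC vval vval_is_monoid_morphism.

Lemma vred_subproof (x : vring) : {ab : algC * algC |
  [/\ ab.1 \in Aint, ab.2 \in Aint, red ab.2 != 0 & vval x = ab.1 / ab.2]}.
Proof.
by apply: cid; case/vringP: (valP x) => a [b H]; exists (a, b).
Qed.

(** The fraction is picked by choice; [vredE] shows that any admissible fraction gives the same
    value. *)
Definition vred (x : vring) : F :=
  let: ab := sval (vred_subproof x) in red ab.1 / red ab.2.

Lemma vredE (x : vring) a b :
    a \in Aint -> b \in Aint -> red b != 0 -> vval x = a / b ->
  vred x = red a / red b.
Proof.
move=> Aa Ab nzb xE; rewrite /vred; case: vred_subproof => [[c d] /= [Ac Ad nzd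
  xE']].
apply/eqP; rewrite eqr_div // -!redM //; apply/eqP; congr (red _).
by apply/eqP; rewrite -eqr_div ?red_neq0 // -xE' -xE.
Qed.

Lemma vred_Aint (x : vring) : vval x \in Aint -> vred x = red (vval x).
Proof.
by move=> Ax; rewrite (@vredE x (vval x) 1) ?divr1 ?red1 ?divr1 ?oner_eq0.
Qed.

Fact vred_is_zmod_morphism : zmod_morphism vred.
Proof.
move=> x y; case/vringP: (valP x) (valP y) => a [b [Aa Ab nzb xE]].
case/vringP=> c [d [Ac Ad nzd yE]].
rewrite (vredE Aa Ab nzb xE) (vredE Ac Ad nzd yE).
rewrite (@vredE _ (a * d - c * b) (b * d)) ?rpredB ?rpredM ?redM ?mulf_neq0 //.
  rewrite redB ?rpredM // !redM // mulrBl -mulf_div divff // mulr1.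
  by rewrite [red b * _]mulrC -mulf_div divff // mulr1.
rewrite rmorphB /= /vval xE yE.
by rewrite mulrBl -mulf_div divff ?red_neq0 // mulr1 [b * d]mulrC -mulf_div
  divff ?red_neq0 // mulr1.
Qed.

Fact vred_is_monoid_morphism : monoid_morphism vred.
Proof.
split; first by rewrite vred_Aint ?rmorph1 ?red1.
move=> x y; case/vringP: (valP x) (valP y) => a [b [Aa Ab nzb xE]].
case/vringP=> c [d [Ac Ad nzd yE]].
rewrite (vredE Aa Ab nzb xE) (vredE Ac Ad nzd yE).
rewrite (@vredE _ (a * c) (b * d)) ?rpredM ?redM ?mulf_neq0 ?mulf_div //.
by rewrite rmorphM /= /vval xE yE mulf_div.
Qed.

HB.instance Definition _ :=
  GRing.isZmodMorphism.Build vring F vred vred_is_zmod_morphism.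
HB.instance Definition _ :=
  GRing.isMonoidMorphism.Build vring F vred vred_is_monoid_morphism.

(* If a is the leading coefficient of q then a and a x are integral, so that  *)
(* x = (a x) / a settles the matter unless both reduce to 0, and then q can   *)
(* be replaced by q - a X^m + (a x) X^(m - 1), of smaller degree.             *)
Lemma vring_total_poly n (q : {poly algC}) x :
    (size q <= n)%N -> q \is a polyOver Aint -> root q x ->
  [\/ x \in vring_pred, x^-1 \in vring_pred | forall i, red q`_i = 0].
Proof.
elim: n q => [|n IHn] q; first by rewrite size_poly_leq0 => /eqP-> _ _; apply:
  Or33 => i; rewrite coef0 red0.
move=> le_q Aq qx0; have [lt1|le1] := ltnP 1 (size q); last first.
  apply: Or33; move: qx0; rewrite (size1_polyC le1) => /rootP; rewrite hornerC
    => q0 i.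
  by rewrite q0 coefC if_same red0.
set a := lead_coef q; have Aax : a * x \in Aint := Aint_lead_coefM Aq qx0 lt1.
have Aa : a \in Aint by apply: (polyOverP Aq).
have nza : a != 0 by rewrite lead_coef_eq0 -size_poly_gt0 ltnW.
have [a0|nz_ra] := eqVneq (red a) 0; last first.
  by apply: Or31; apply/vringP; exists (a * x), a; rewrite mulrAC divff ?mul1r.
have [ax0|nz_rax] := eqVneq (red (a * x)) 0; last first.
  apply: Or32; apply/vringP; exists a, (a * x); split=> //.
  by rewrite invfM mulrA divff ?mul1r.
case sq: (size q) lt1 le_q => [|[|m]] // _ le_q.
pose r := q - a *: 'X^(m.+1) + (a * x) *: 'X^m.
have rE i : r`_i = q`_i - a *+ (i == m.+1) + (a * x) *+ (i == m).
  by rewrite !coefE !mulr_natr.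
have Ar : r \is a polyOver Aint.
  by apply/polyOverP=> i; rewrite rE rpredD ?rpredB ?rpredMn ?(polyOverP Aq).
have [||ox|ox'|r0] := IHn r _ Ar; try by [apply: Or31 | apply: Or32].
- apply: leq_trans (_ : m.+1 <= n)%N; last by rewrite -ltnS.
  apply/leq_sizeP=> i lt_mi; rewrite rE (gtn_eqF lt_mi) addr0.
  case: eqP => [->|/eqP nei]; first by rewrite {1}/a lead_coefE sq subrr.
  by rewrite subr0 nth_default // sq ltn_neqAle eq_sym nei.
- by apply/rootP; rewrite !hornerE (rootP qx0) sub0r exprS mulrA addNr.
apply: Or33 => i; have := r0 i; rewrite rE redD ?redB ?rpredB ?rpredMn
  ?(polyOverP Aq) //.
have zero b (c : bool) : red b = 0 -> red (b *+ c) = 0 by case: c; rewrite //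
  red0.
by rewrite (zero a) // (zero (a * x)) // subr0 addr0.
Qed.

(** Apply [vring_total_poly] to a primitive integer polynomial with root [x]: its coefficients
    cannot all reduce to 0, for then p would divide its content. *)
Lemma vring_total x : x \in vring_pred \/ x^-1 \in vring_pred.
Proof.
have [q [Dq mon_q] _] := minCpolyP x.
have [r [a nz_a Dr]] := rat_poly_scale q.
pose s := zprimitive r.
have nz_r : r != 0.
  apply: contraTneq mon_q => r0; rewrite Dr r0 rmorph0 scaler0.
  by rewrite monicE lead_coef0 eq_sym oner_eq0.
have sx0 : root (map_poly intr s : {poly algC}) x.
  have: root (map_poly intr r : {poly algC}) x.
    have := root_minCpoly x; rewrite Dq Dr map_polyZ rootZ; last first.
      by rewrite fmorph_eq0 invr_eq0 intr_eq0.
    by rewrite -map_poly_comp; congr (root _ x); apply: eq_map_poly => b /=;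
      rewrite ratr_int.
  rewrite {1}[r]zpolyEprim map_polyZ rootZ //.
  by rewrite intr_eq0 zcontents_eq0.
have [|ox|ox'|s0] := vring_total_poly (leqnn _) _ sx0; first by
  apply/polyOverP=> i; rewrite coef_map Aint_int.
- by left.
- by right.
have pdvd : (p %| zcontents s)%Z.
  rewrite dvdz_contents; apply/polyOverP=> i.
  have:= s0 i; rewrite coef_map /= red_int; case: (s`_i) => m.
    by move/eqP; rewrite -(dvdn_pcharf (red_char red)).
  by rewrite NegzE mulrNz => /eqP; rewrite oppr_eq0 -(dvdn_pcharf (red_char
    red)) rpredN.
move: pdvd; rewrite zcontents_primitive nz_r dvdz1 => /eqP p1.
by have := pcharf_prime (red_char red); move: p1 => /= ->.
Qed.

(** Divisibility over a valuation ring is a total preorder, so a finite family has a member dividing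
    all others. Dividing by it makes a family integral with one entry equal to 1. *)
Lemma vring_max_val (I : finType) (P : pred I) (c : I -> algC) i0 :
  P i0 -> c i0 != 0 ->
  exists2 i, P i && (c i != 0) & forall j, P j -> c j / c i \in vring_pred.
Proof.
move=> Pi0 nz0.
suff [i Pi Hi]: exists2 i, P i && (c i != 0) &
    {in enum P, forall j, c j / c i \in vring_pred}.
  by exists i => // j Pj; apply: Hi; rewrite mem_enum.
have: {subset enum P <= P} by move=> j; rewrite mem_enum.
elim: (enum P) => [|j s IHs] sP; first by exists i0; rewrite ?Pi0.
have [|i /andP[Pi nzi] Hi] := IHs; first by move=> k sk; apply: sP; rewrite inE
  sk orbT.
have Pj : P j by apply: sP; rewrite mem_head.
have [ij|ji] := vring_total (c j / c i).
  by exists i; rewrite ?Pi // => k /predU1P[->|/Hi].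
have [cj0|nzj] := eqVneq (c j) 0.
  by exists i; rewrite ?Pi // => k /predU1P[->|/Hi //]; rewrite cj0 mul0r
    rpred0.
exists j; rewrite ?Pj //= => k /predU1P[->|sk]; first by rewrite divff ?rpred1.
have -> : c k / c j = (c k / c i) * (c j / c i)^-1 by rewrite invf_div mulrA
  divfK.
by rewrite rpredM ?Hi.
Qed.

End Reduction.

(** * Representations over an algebraically closed field *)

(** The two dimensions are kept apart in the types, so that the lemma covers a change to a basis
    adapted to a submodule, of size [\rank U + \rank (cokermx U)]. *)
Lemma char_poly_conj (F : fieldType) m n (B : 'M[F]_(m, n)) (C : 'M[F]_(n, m))
    (A : 'M[F]_n) :
  B *m C = 1%:M -> C *m B = 1%:M -> char_poly (B *m A *m C) = char_poly A.
Proof.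
move=> BC CB; have eq_mn : m = n.
  have le i j (X : 'M[F]_(i, j)) (Y : 'M_(j, i)) : X *m Y = 1%:M -> (i <= j)%N.
    by move=> XY; rewrite -(mxrank1 F i) -XY (leq_trans (mxrankM_maxl _ _))
      ?rank_leq_col.
  by apply/eqP; rewrite eqn_leq (le _ _ _ _ BC) (le _ _ _ _ CB).
case: n / eq_mn in B C A BC CB *.
pose Bx := map_mx polyC B; pose Cx := map_mx polyC C.
have BCx : Bx *m Cx = 1%:M by rewrite -map_mxM BC map_mx1.
rewrite /char_poly.
have -> : char_poly_mx (B *m A *m C) = Bx *m char_poly_mx A *m Cx.
  rewrite /char_poly_mx !map_mxM mulmxBr mulmxBl.
  by rewrite mul_mx_scalar -scalemxAl BCx scalemx1.
by rewrite !det_mulmx mulrAC -det_mulmx BCx det1 mul1r.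
Qed.

Section GroupRing.

Variables (F : fieldType) (gT : finGroupType) (G : {group gT}).
Local Notation aG := (regular_repr F G).

Lemma gring_op_sum n (rG : mx_representation F G n) A :
  gring_op rG A = \sum_(x in G) gring_proj x A 0 0 *: rG x.
Proof.
rewrite gring_opE /gring_mx /= mulmx_sum_row linear_sum /=.
have G1 := group1 G; rewrite (reindex (@enum_val gT (mem G))) /=; last first.
  exact: enum_val_bij_in G1.
apply: eq_big => [i|i _]; first by rewrite enum_valP.
by rewrite linearZ /= rowK mxvecK /gring_proj /= !mxE gring_valK.
Qed.

Lemma gring_op_hom n n' (rG : mx_representation F G n)
    (rG' : mx_representation F G n') (B : 'M_(n, n')) A :
    (forall x, x \in G -> rG x *m B = B *m rG' x) ->
  gring_op rG A *m B = B *m gring_op rG' A.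
Proof.
move=> homB; rewrite !gring_op_sum mulmx_suml mulmx_sumr; apply: eq_bigr => x
  Gx.
by rewrite -scalemxAl homB // scalemxAr.
Qed.

Lemma gring_op_rsim n n' (rG : mx_representation F G n)
    (rG' : mx_representation F G n') A c :
  mx_rsim rG rG' -> gring_op rG A = c%:M -> gring_op rG' A = c%:M.
Proof.
case/mx_rsim_sym => B _ freeB /gring_op_hom homB opA.
by apply: (row_free_inj freeB); rewrite homB opA scalar_mxC.
Qed.

Lemma gring_op_surj n (rG : mx_representation F G n) (X : 'M_n) :
  mx_absolutely_irreducible rG ->
  exists2 A, (A \in group_ring F G)%MS & gring_op rG A = X.
Proof.
case/mx_abs_irrP=> _ [a aE]; exists (\sum_(x in G) a x X *: aG x).
  by apply/envelop_mxP; exists (a^~ X).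
rewrite linear_sum [RHS]aE; apply: eq_bigr => x Gx.
by rewrite linearZ /= gring_opG.
Qed.

Section SubFact.

Variables (n : nat) (rG : mx_representation F G n) (U : 'M[F]_n).
Hypothesis modU : mxmodule rG U.
Let rU := submod_repr modU.
Let rV := factmod_repr modU.

Lemma submod_hom x : x \in G -> rU x *m val_submod 1%:M = val_submod 1%:M *m rG
  x.
Proof. by move=> Gx; rewrite -val_submodE -[rU x]mul1mx val_submodJ. Qed.

Lemma factmod_hom x : x \in G -> rG x *m in_factmod U 1%:M = in_factmod U 1%:M
  *m rV x.
Proof. by move=> Gx; rewrite -in_factmodE -[rG x]mul1mx in_factmodJ. Qed.

Lemma in_val_factmod1 : val_factmod 1%:M *m in_factmod U 1%:M = 1%:M.
Proof. by rewrite -in_factmodE val_factmodK. Qed.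

Lemma gring_op_submod A c : gring_op rG A = c%:M -> gring_op rU A = c%:M.
Proof.
move=> opA; apply: (@val_submod_inj _ _ U); rewrite [LHS]val_submodE
  [RHS]val_submodE.
by rewrite (gring_op_hom _ submod_hom) opA scalar_mxC.
Qed.

Lemma gring_op_factmod A c : gring_op rG A = c%:M -> gring_op rV A = c%:M.
Proof.
move=> opA; have := gring_op_hom A factmod_hom; rewrite opA => opV.
rewrite -[LHS]mul1mx -in_val_factmod1 -mulmxA -opV.
by rewrite mul_scalar_mx -scalemxAr in_val_factmod1 scalemx1.
Qed.

(** In a basis adapted to [U] the matrix is block lower triangular, with the submodule and the
    quotient on the diagonal. *)
Lemma char_poly_sub_fact x : x \in G ->
  char_poly (rG x) = char_poly (rU x) * char_poly (rV x).
Proof.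
move=> Gx.
pose B1 : 'M_(\rank U, n) := val_submod 1%:M.
pose B2 : 'M_(\rank (cokermx U), n) := val_factmod 1%:M.
pose C1 := in_submod U 1%:M; pose C2 := in_factmod U 1%:M.
have CB : row_mx C1 C2 *m col_mx B1 B2 = 1%:M.
  by rewrite mul_row_col -val_submodE -val_factmodE add_sub_fact_mod.
have B1C2 : B1 *m C2 = 0.
  by apply/eqP; rewrite -in_factmodE in_factmod_eq0 val_submodP.
have B1C1 : B1 *m C1 = 1%:M by rewrite -in_submodE val_submodK.
have B2C2 : B2 *m C2 = 1%:M by rewrite -in_factmodE val_factmodK.
(* Multiplying [CB] by [B2] on the left and [C1] on the right gives B2 C1 + B2 C1 = B2 C1. *)
have B2C1 : B2 *m C1 = 0.
  move: {Gx}B1 B2 C1 C2 CB B1C2 B1C1 B2C2 => B1 B2 C1 C2 CB _ B1C1 B2C2.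
  have := congr1 (fun X => B2 *m X *m C1) CB; rewrite /= mul_row_col mulmx1.
  rewrite mulmxDr mulmxDl !mulmxA B2C2 mul1mx -(mulmxA _ B1) B1C1 mulmx1.
  by move/(canRL (addrK _)); rewrite subrr.
have BC : col_mx B1 B2 *m row_mx C1 C2 = 1%:M.
  by rewrite mul_col_row B1C1 B1C2 B2C1 B2C2 -scalar_mx_block.
rewrite -(char_poly_conj (rG x) BC CB) mul_col_mx mul_col_row.
have -> : B1 *m rG x *m C1 = rU x by rewrite -in_submodE.
have -> : B2 *m rG x *m C2 = rV x by rewrite -in_factmodE.
have -> : B1 *m rG x *m C2 = 0.
  by rewrite -mulmxA factmod_hom // mulmxA B1C2 mul0mx.
rewrite /char_poly.
have -> : char_poly_mx (block_mx (rU x) 0 (B2 *m rG x *m C1) (rV x))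
  = block_mx (char_poly_mx (rU x)) 0 (- map_mx polyC (B2 *m rG x *m C1))
    (char_poly_mx (rV x)).
  rewrite /char_poly_mx map_block_mx scalar_mx_block opp_block_mx add_block_mx.
  by rewrite map_mx0 oppr0 addr0 add0r.
by rewrite det_lblock.
Qed.

End SubFact.

(** Induction on the dimension, standing in for a composition series. *)
Lemma mx_repr_ind (P : forall n, mx_representation F G n -> Prop) :
    (forall n (rG : mx_representation F G n), n = 0%N -> P n rG) ->
    (forall n (rG : mx_representation F G n), mx_irreducible rG -> P n rG) ->
    (forall n (rG : mx_representation F G n) U (modU : mxmodule rG U),
      P _ (submod_repr modU) -> P _ (factmod_repr modU) -> P n rG) ->
  forall n (rG : mx_representation F G n), P n rG.
Proof.
move=> P0 Pirr Pext n; have [m] := ubnP n; elim: m n => // m IHm n le_nm rG.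
have [/P0 //|n_gt0] := posnP n.
have [/Pirr //|] := pselect (mx_irreducible rG).
move=> /mx_irrP /not_andP[//|/existsNP[U /not_implyP[modU /not_implyP[nzU
  nfullU]]]].
apply: (Pext _ _ _ modU); apply: IHm; rewrite ltnS in le_nm.
  apply: leq_trans le_nm; rewrite ltn_neqAle rank_leq_col andbT.
  by apply/negP.
apply: leq_trans le_nm; rewrite mxrank_coker ltn_subrL n_gt0 andbT.
by rewrite lt0n mxrank_eq0.
Qed.

End GroupRing.

(** Restrict to the cyclic group of [x], whose irreducible representations are linear. There the
    p-part acts by some c with c^(p^k) = 1, and (c - 1)^(p^k) = c^(p^k) - 1 forces c = 1 in
    characteristic p. *)
Lemma char_poly_p_part (p : nat) (F : closedFieldType) (gT : finGroupType)
    (G : {group gT}) n (rG : mx_representation F G n) x :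
    p \in [pchar F] -> x \in G ->
  char_poly (rG x) = char_poly (rG x.`_p^').
Proof.
move=> charFp Gx; have sxG : <[x]> \subset G by rewrite cycle_subG.
rewrite -[rG x]/(subg_repr rG sxG x) -[rG _]/(subg_repr rG sxG x.`_p^').
elim/mx_repr_ind: {n rG}(subg_repr rG sxG) => n rG.
- by move=> n0; move: rG; rewrite n0 => rG; rewrite /char_poly !det_mx00.
- move=> irrG.
  have splitF := @group_closure_closed_field F gT.
  have n1 := mx_irr_abelian_linear (splitF _) irrG (cycle_abelian x).
  move: rG irrG; rewrite n1 => rG _; congr char_poly.
  have -> : rG x = rG x.`_p *m rG x.`_p^'.
    by rewrite -repr_mxM ?groupX ?cycle_id // consttC.
  suff ->: rG x.`_p = 1%:M by rewrite mul1mx.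
  rewrite [rG x.`_p]mx11_scalar; congr (_%:M); set c := rG _ 0 0.
  have /p_natP[k ok] : p.-nat #[x.`_p] by apply: p_elt_constt.
  have: c ^+ (p ^ k) = 1.
    have xc : rG x.`_p = c%:M by rewrite -mx11_scalar.
    have := expg_order x.`_p; rewrite ok => /(congr1 rG).
    rewrite repr_mx1 repr_mxX ?groupX ?cycle_id //.
    by rewrite xc -rmorphXn => /matrixP/(_ 0 0); rewrite !mxE.
  move=> cq; apply/eqP; rewrite -subr_eq0.
  suff: (c - 1) ^+ (p ^ k) == 0 by rewrite expf_eq0 => /andP[].
  have pq : [pchar F].-nat (p ^ k)%N.
    by rewrite (eq_pnat _ (pcharf_eq charFp)) pnatX pnat_id ?(pcharf_prime
      charFp).
  by rewrite exprDn_pchar // exprNn_pchar // cq expr1n subrr.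
move=> U modU IHU IHV.
by rewrite !(char_poly_sub_fact modU) ?IHU ?IHV ?mem_cycle ?groupX ?cycle_id.
Qed.

Lemma delta_mulmx_delta (R : comNzRingType) m n k l (M : 'M[R]_(n, k))
    (i : 'I_m) (u : 'I_n) (v : 'I_k) (j : 'I_l) :
  delta_mx i u *m M *m delta_mx v j = M u v *: delta_mx i j.
Proof.
rewrite -(mul_delta_mx (0 : 'I_1) i u) -(mul_delta_mx (0 : 'I_1) v j) !mulmxA.
rewrite -(mulmxA _ _ M) -rowE -(mulmxA _ _ (delta_mx v _)) -colE.
by rewrite [col _ _]mx11_scalar !mxE mul_mx_scalar -scalemxAl mul_delta_mx.
Qed.

(** * Separating irreducible representations by elements of the group algebra *)

Section Separation.

Variables (F : closedFieldType) (gT : finGroupType) (G : {group gT}).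
Local Notation aG := (regular_repr F G).
Local Notation R_G := (group_ring F G).

Lemma mx_irr_abs n (rG : mx_representation F G n) :
  mx_irreducible rG -> mx_absolutely_irreducible rG.
Proof. exact: group_closure_closed_field. Qed.

(** Schur's lemma: the kernel and the image of [B] are submodules. *)
Lemma mx_irr_hom_rsim n n' (rG : mx_representation F G n)
    (rG' : mx_representation F G n') (B : 'M_(n, n')) :
    mx_irreducible rG -> mx_irreducible rG' -> B != 0 ->
    (forall x, x \in G -> rG x *m B = B *m rG' x) ->
  mx_rsim rG rG'.
Proof.
move=> /mx_irrP[n_gt0 irrG] /mx_irrP[n'_gt0 irrG'] nzB homB.
have freeB : row_free B.
  rewrite -kermx_eq0; apply: contraNT nzB => nzK.
  have modK : mxmodule rG (kermx B).
    apply/mxmoduleP=> x Gx; apply/sub_kermxP.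
    by rewrite -mulmxA homB // mulmxA mulmx_ker mul0mx.
  have /row_fullP[X XK] := irrG _ modK nzK.
  by rewrite -[B]mul1mx -XK -mulmxA mulmx_ker mulmx0.
have fullB : row_full B.
  have modB : mxmodule rG' <<B>>%MS.
    rewrite (eqmx_module _ (genmxE _)); apply/mxmoduleP=> x Gx.
    by rewrite -homB // submxMl.
  by have := irrG' _ modB; rewrite (eqmx_eq0 (genmxE _)) /row_full genmxE;
    apply.
exists B => //; move: freeB fullB; rewrite /row_free /row_full.
by move=> /eqP -> /eqP.
Qed.

(* If the kernel of rG' on FG annihilates rG, then rG factors through a       *)
(* matrix algebra, whose first row yields a nonzero homomorphism rG' -> rG.   *)
Lemma irr_separation2 n n' (rG : mx_representation F G n)
    (rG' : mx_representation F G n') :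
    mx_irreducible rG -> mx_irreducible rG' -> ~ mx_rsim rG' rG ->
  exists A, [/\ (A \in R_G)%MS, gring_op rG A = 1%:M & gring_op rG' A = 0].
Proof.
move=> irrG irrG' nsim.
have [absG absG'] := (mx_irr_abs irrG, mx_irr_abs irrG').
have [[M [RM opM /eqP/matrix0Pn[u [v nzM]]]]|kerG] := pselect (exists M,
    [/\ (M \in R_G)%MS, gring_op rG' M = 0 & gring_op rG M <> 0]).
  have repE i : exists BC : 'M_(gcard G) * 'M_(gcard G), [/\ (BC.1 \in R_G)%MS,
    (BC.2 \in R_G)%MS,
      gring_op rG BC.1 = delta_mx i u & gring_op rG BC.2 = delta_mx v i].
    have [B RB opB] := gring_op_surj (delta_mx i u) absG.
    by have [C RC opC] := gring_op_surj (delta_mx v i) absG; exists (B, C).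
  have [BC BCP] := fin_all_exists repE.
  (* Sandwiching [M] between matrix units gives M_uv E_ii; summing over i and dividing by M_uv gives
     the identity. *)
  exists ((gring_op rG M u v)^-1 *: \sum_i (BC i).1 *m M *m (BC i).2); split.
  - rewrite linearZ scalemx_sub // linear_sum summx_sub // => i _.
    by have [RB RC _ _] := BCP i; rewrite !envelop_mxM.
  - rewrite linearZ linear_sum /= mx1_sum_delta; under eq_bigr => i _.
      have [RB RC opB opC] := BCP i; rewrite !gring_opM // opB opC
        delta_mulmx_delta; over.
    by rewrite -scaler_sumr scalerA mulVf // scale1r.
  - rewrite linearZ linear_sum /= big1 ?scaler0 // => i _.
    by have [RB RC _ _] := BCP i; rewrite !gring_opM // opM mulmx0 mul0mx.
have {}kerG M : (M \in R_G)%MS -> gring_op rG' M = 0 -> gring_op rG M = 0.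
  by move=> RM opM; apply: contrapT => nz; apply: kerG; exists M.
case: nsim; have [n_gt0 _] := (mx_irrP _).1 irrG; have [n'_gt0 _] := (mx_irrP
  _).1 irrG'.
pose i0 := Ordinal n'_gt0.
have repE i : exists B : 'M_(gcard G), (B \in R_G)%MS /\ gring_op rG' B =
  delta_mx i0 i.
  by have [B RB opB] := gring_op_surj (delta_mx i0 i) absG'; exists B.
have repE' i : exists B : 'M_(gcard G), (B \in R_G)%MS /\ gring_op rG' B =
  delta_mx i i0.
  by have [B RB opB] := gring_op_surj (delta_mx i i0) absG'; exists B.
have [B /all_and2[RB opB]] := fin_all_exists repE.
have [C /all_and2[RC opC]] := fin_all_exists repE'.
have nzB : gring_op rG (B i0) != 0.
  apply/eqP => B0.
  pose S := \sum_i C i *m B i0 *m B i.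
  have RS : (S \in R_G)%MS.
    by rewrite linear_sum summx_sub // => i _; rewrite !envelop_mxM.
  have opS : gring_op rG' S = 1%:M.
    rewrite linear_sum mx1_sum_delta /=; apply: eq_bigr => i _.
    by rewrite !gring_opM // opB opB opC !mul_delta_mx.
  have: gring_op rG (1%:M - S) = 0.
    apply: kerG; last by rewrite linearB /= opS gring_op1 subrr.
    by rewrite linearB addmx_sub ?envelop_mx1 // eqmx_opp.
  rewrite linearB /= gring_op1 linear_sum big1 => [|i _]; last first.
    by rewrite /= !gring_opM // B0 mulmx0 mul0mx.
  move/matrixP/(_ (Ordinal n_gt0) (Ordinal n_gt0)); rewrite !mxE eqxx subr0.
  by move/eqP; rewrite oner_eq0.
have /matrix0Pn[r [c nzrc]] := nzB.
pose H := \matrix_j row r (gring_op rG (B j)).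
apply: (mx_irr_hom_rsim (B := H) irrG' irrG) => [|x Gx].
  by apply/matrix0Pn; exists i0, c; rewrite mxE mxE.
apply/row_matrixP=> j; rewrite !row_mul rowK.
pose D := \sum_k rG' x j k *: B k.
have RD : (D \in R_G)%MS.
  by rewrite linear_sum summx_sub // => k _; rewrite linearZ scalemx_sub ?RB.
have opD : gring_op rG' (D - B j *m aG x) = 0.
  rewrite linearB /= gring_opM ?envelop_mx_id // gring_opG // opB.
  apply/eqP; rewrite subr_eq0; apply/eqP; rewrite linear_sum /=.
  rewrite -(mul_delta_mx (0 : 'I_1)) -mulmxA -rowE [row _ _]row_sum_delta
    mulmx_sumr.
  apply: eq_bigr => k _; rewrite linearZ /= opB mxE -scalemxAr.
  by rewrite mul_delta_mx.
have RDB : (D - B j *m aG x \in R_G)%MS.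
  by rewrite linearB addmx_sub // eqmx_opp envelop_mxM ?envelop_mx_id.
have /eqP := kerG _ RDB opD.
rewrite linearB subr_eq0 /= gring_opM ?envelop_mx_id // gring_opG // => /eqP H0.
rewrite -[RHS]row_mul -H0.
rewrite mulmx_sum_row !linear_sum /=; apply: eq_bigr => k _.
by rewrite rowK mxE !linearZ.
Qed.

(** Multiply the elements that separate [i0] from each other index. *)
Lemma irr_separation (I : finType) (n : I -> nat)
    (rG : forall i, mx_representation F G (n i)) i0 :
    (forall i, mx_irreducible (rG i)) ->
    (forall i j, mx_rsim (rG i) (rG j) -> i = j) ->
  exists A, [/\ (A \in R_G)%MS, gring_op (rG i0) A = 1%:M
    & forall i, i != i0 -> gring_op (rG i) A = 0].
Proof.
move=> irrG simG.
suff [A [RA opA0 opA]]: exists A, [/\ (A \in R_G)%MS, gring_op (rG i0) A = 1%:M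
    & {in enum I, forall i, i != i0 -> gring_op (rG i) A = 0}].
  by exists A; split=> // i; apply: opA; rewrite mem_enum.
elim: (enum I) => [|i s [A [RA opA0 opA]]].
  by exists 1%:M; rewrite envelop_mx1 gring_op1.
have [->|ni] := eqVneq i i0.
  by exists A; split=> // j /predU1P[->|/opA //]; rewrite eqxx.
have [|B [RB opB0 opB]] := irr_separation2 (irrG i0) (irrG i).
  by move/simG/eqP; rewrite (negPf ni).
exists (A *m B); rewrite envelop_mxM // gring_opM // opA0 opB0 mulmx1.
split=> // j /predU1P[->|sj] nj; first by rewrite gring_opM // opB mulmx0.
by rewrite gring_opM // opA // mul0mx.
Qed.

(** Evaluate at an element acting as a diagonal matrix unit on [rG i0] and as 0 on the others. The
    matrix unit has trace 1, whereas the trace of the identity could be 0 in characteristic p. *)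
Lemma irr_trace_independent (I : finType) (n : I -> nat)
    (rG : forall i, mx_representation F G (n i)) (c : I -> F) :
    (forall i, mx_irreducible (rG i)) ->
    (forall i j, mx_rsim (rG i) (rG j) -> i = j) ->
    {in G, forall x, \sum_i c i * \tr (rG i x) = 0} ->
  forall i, c i = 0.
Proof.
move=> irrG simG c0 i0.
have [A [RA opA0 opA]] := irr_separation i0 irrG simG.
have [n_gt0 _] := (mx_irrP _).1 (irrG i0); pose k := Ordinal n_gt0.
have [B RB opB] := gring_op_surj (delta_mx k k) (mx_irr_abs (irrG i0)).
have: \sum_i c i * \tr (gring_op (rG i) (A *m B)) = 0.
  under eq_bigr => i _ do rewrite gring_op_sum linear_sum mulr_sumr.
  rewrite exchange_big /= big1 // => x Gx.
  under eq_bigr => i _ do rewrite linearZ /= mulrCA.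
  by rewrite -mulr_sumr c0 ?mulr0.
rewrite (bigD1 i0) //= big1 ?addr0 => [|i ni]; last first.
  by rewrite gring_opM // opA // mul0mx linear0 mulr0.
rewrite gring_opM // opA0 mul1mx opB.
have -> : \tr (delta_mx k k : 'M[F]_(n i0)) = 1.
  rewrite /mxtrace (bigD1 k) //= mxE eqxx big1 ?addr0 // => i ni.
  by rewrite mxE (negPf ni).
by rewrite mulr1.
Qed.

End Separation.

(** * Brauer characters *)

Lemma mxtrace_split (F : fieldType) n (A : 'M[F]_n) s :
  char_poly A = \prod_(z <- s) ('X - z%:P) -> \tr A = \sum_(z <- s) z.
Proof.
move=> splitA; have sz: size s = n.
  by apply: succn_inj; rewrite -(size_char_poly A) splitA size_prod_XsubC.
have [n0|n_gt0] := posnP n.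
  rewrite (size0nil (etrans sz n0)) big_nil.
  by rewrite /mxtrace big1 // => -[k ltk]; exfalso; move: ltk; rewrite n0.
apply: oppr_inj; rewrite -char_poly_trace // splitA -sz coefPn_prod_XsubC //.
by rewrite sz -lt0n.
Qed.

Section Brauer.

Variables (p : nat) (F : closedFieldType) (red : p_reduction p F).

(** The factorization of X^m - 1 reduces to one in [F], and X^m - 1 is separable there, so the
    powers of [red w] stay distinct. *)
Lemma red_prim_root m w : ~~ (p %| m)%N -> m.-primitive_root w ->
  m.-primitive_root (red w).
Proof.
move=> p'm prim_w; have Aw := Aint_prim_root prim_w.
have m_gt0 := prim_order_gt0 prim_w.
have redX k : red (w ^+ k) = red w ^+ k.
  elim: k => [|k IHk]; first by rewrite red1.
  by rewrite !exprS redM ?rpredX ?IHk.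
pose wO : vring red := Sub w (Aint_vring red Aw).
have wOE : vred wO = red w by rewrite vred_Aint.
have prodO : \prod_(0 <= i < m) ('X - (wO ^+ i)%:P) = 'X^m - 1.
  apply: (map_inj_poly (@vval_inj _ _ _)); first exact: rmorph0.
  rewrite rmorph_prod rmorphB /=. rewrite map_polyXn rmorph1 -(factor_Xn_sub_1
    prim_w).
  by apply: eq_bigr => i _; rewrite rmorphB /= map_polyX map_polyC /= rmorphXn.
have prodF : \prod_(z <- [seq red w ^+ i | i <- index_iota 0 m]) ('X - z%:P) =
  'X^m - 1.
  have := congr1 (map_poly (vred (red := red))) prodO.
  rewrite rmorph_prod rmorphB /= map_polyXn rmorph1 big_map => <-.
  by apply: eq_bigr => i _; rewrite rmorphB /= map_polyX map_polyC /= -wOE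
    -rmorphXn.
have: uniq [seq red w ^+ i | i <- index_iota 0 m].
  rewrite -separable_prod_XsubC prodF separable_Xn_sub_1 //.
  by rewrite -(dvdn_pcharf (red_char red)).
rewrite /index_iota subn0 => uniq_w.
have wm1 : red w ^+ m = 1 by rewrite -redX prim_expr_order // red1.
have [k prim_k km] := prim_order_exists m_gt0 wm1.
have [->//|ltkm] := eqVneq m k.
have lt_km : (k < m)%N by rewrite ltn_neqAle eq_sym ltkm dvdn_leq.
have := mkseq_uniqP _ _ uniq_w 0%N k; rewrite !inE m_gt0 lt_km => /(_ isT isT
  (esym (prim_expr_order prim_k))) k0.
by have := prim_order_gt0 prim_k; rewrite -k0.
Qed.

Lemma red_unity_root_inj m : ~~ (p %| m)%N ->
  {in m.-unity_root &, injective red}.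
Proof.
move=> p'm z z'; have [m0|m_gt0] := posnP m; first by rewrite m0 dvdn0 in p'm.
have [w prim_w] := C_prim_root_exists m_gt0.
have prim_rw := red_prim_root p'm prim_w.
have redX k : red (w ^+ k) = red w ^+ k.
  elim: k => [|k IHk]; first by rewrite red1.
  by rewrite !exprS redM ?rpredX ?IHk // (Aint_prim_root prim_w).
move=> /unity_rootP/(prim_rootP prim_w)[i ->] /unity_rootP/(prim_rootP
  prim_w)[j ->].
rewrite !redX => /eqP; rewrite (eq_prim_root_expr prim_rw) => eq_ij.
by apply/eqP; rewrite (eq_prim_root_expr prim_w).
Qed.

Lemma red_unity_root_surj m y : ~~ (p %| m)%N -> y ^+ m = 1 ->
  exists2 z, m.-unity_root z & red z = y.
Proof.
move=> p'm ym1; have [m0|m_gt0] := posnP m; first by rewrite m0 dvdn0 in p'm.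
have [w prim_w] := C_prim_root_exists m_gt0.
have prim_rw := red_prim_root p'm prim_w.
have [i ->] := prim_rootP prim_rw ym1; exists (w ^+ i).
  by apply/unity_rootP; rewrite exprAC (prim_expr_order prim_w) expr1n.
elim: (nat_of_ord i) => [|k IHk]; first by rewrite red1.
by rewrite !exprS redM ?rpredX ?IHk // (Aint_prim_root prim_w).
Qed.

(** Inverse of [red] on m-th roots of unity for m prime to p; 0 is a default for elements without a
    lift. *)
Definition unity_lift m (y : F) : algC :=
  match pselect (exists2 z, m.-unity_root z & red z = y) with
  | left ex => s2val (cid2 ex) | right _ => 0 end.

Lemma unity_liftK m y : ~~ (p %| m)%N -> y ^+ m = 1 ->
  m.-unity_root (unity_lift m y) /\ red (unity_lift m y) = y.
Proof.
move=> p'm /(red_unity_root_surj p'm) ex; rewrite /unity_lift.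
by case: pselect => // ex'; case: (cid2 ex').
Qed.

Lemma red_unity_liftK m z : ~~ (p %| m)%N -> m.-unity_root z ->
  unity_lift m (red z) = z.
Proof.
move=> p'm uz; rewrite /unity_lift; case: pselect => [ex|[]]; last by exists z.
by case: (cid2 ex) => z' uz' /= /(red_unity_root_inj p'm uz' uz).
Qed.

Variables (gT : finGroupType) (G : {group gT}).
Local Notation Greg := (p_regular p G).

Lemma p_regularP x : reflect (x \in G /\ p^'.-elt x) (x \in Greg).
Proof. by rewrite inE; apply: andP. Qed.

Lemma p'_order x : x \in Greg -> ~~ (p %| #[x])%N.
Proof.
have pr_p := pcharf_prime (red_char red).
by case/p_regularP => _; rewrite /p_elt p'natE.
Qed.

Lemma p_regularJ x y : y \in G -> ((x ^ y)%g \in Greg) = (x \in Greg).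
Proof. by move=> Gy; rewrite !inE groupJr // /p_elt orderJ. Qed.

Lemma p_regular_normal : Greg <| G.
Proof.
apply/andP; split; first by apply/subsetP => x /p_regularP[].
apply/subsetP=> y Gy; rewrite inE; apply/subsetP=> _ /imsetP[x Rx ->].
by rewrite p_regularJ.
Qed.

Lemma p_regular_constt x : x \in G -> x.`_p^' \in Greg.
Proof. by move=> Gx; apply/p_regularP; rewrite groupX // p_elt_constt. Qed.

Section OneRepresentation.

Variables (n : nat) (rG : mx_representation F G n).

Lemma root_char_poly_repr x a :
  x \in G -> root (char_poly (rG x)) a -> a ^+ #[x] = 1.
Proof.
move=> Gx; rewrite -eigenvalue_root_char => /eigenvalueP[v vx nzv].
have vk k : v *m rG (x ^+ k)%g = a ^+ k *: v.
  elim: k => [|k IHk]; first by rewrite repr_mx1 mulmx1 scale1r.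
  by rewrite expgS repr_mxM ?groupX // mulmxA vx -scalemxAl IHk scalerA exprS.
have := vk #[x]; rewrite expg_order repr_mx1 mulmx1 -[v in LHS]scale1r => /eqP.
rewrite -subr_eq0 -scalerBl scaler_eq0 (negPf nzv) orbF subr_eq0.
by move/eqP.
Qed.

Definition spectrum (q : {poly F}) : seq F := sval (closed_field_poly_normal q).

Lemma spectrumE m (A : 'M[F]_m) :
  char_poly A = \prod_(z <- spectrum (char_poly A)) ('X - z%:P).
Proof.
rewrite /spectrum; case: closed_field_poly_normal => s /= {1}->.
by rewrite (monicP (char_poly_monic A)) scale1r.
Qed.

Definition Brauer_fun x : algC := if x \in Greg then
  \sum_(a <- spectrum (char_poly (rG x))) unity_lift #[x] a else 0.

Fact Brauer_subproof : is_class_fun <<G>> (finfun Brauer_fun).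
Proof.
rewrite genGid; apply: intro_class_fun => [x y Gx Gy | x]; last first.
  by rewrite /Brauer_fun inE => /negPf->.
rewrite /Brauer_fun p_regularJ // orderJ; congr (if _ then \sum_(a <- spectrum
  _) _ else _).
rewrite conjgE !repr_mxM ?groupM ?groupV // mulmxA.
by apply: char_poly_conj; rewrite -repr_mxM ?groupV // ?mulgV ?mulVg repr_mx1.
Qed.

Definition Brauer_char := Cfun 0 Brauer_subproof.

Lemma Brauer_char_affords : affords_Brauer_char red rG Brauer_char.
Proof.
split.
  apply/cfun_onP=> x R'x.
  by rewrite cfunE /Brauer_fun (negPf R'x).
move=> x Rx; have [Gx _] := p_regularP _ Rx; have p'x := p'_order Rx.
set s := spectrum (char_poly (rG x)).
have sP a : a \in s -> a ^+ #[x] = 1.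
  move=> sa; apply: (root_char_poly_repr Gx).
  by rewrite spectrumE root_prod_XsubC.
exists (map (unity_lift #[x]) s); split.
- by apply/allP=> _ /mapP[a sa ->]; case: (unity_liftK p'x (sP a sa)).
- rewrite {1}spectrumE big_map; apply: eq_big_seq => a sa.
  by case: (unity_liftK p'x (sP a sa)) => _ ->.
by rewrite cfunE /Brauer_fun Rx big_map.
Qed.

Lemma affords_unity_lift phi x s :
    affords_Brauer_char red rG phi -> x \in Greg ->
    char_poly (rG x) = \prod_(a <- s) ('X - a%:P) ->
  phi x = \sum_(a <- s) unity_lift #[x] a.
Proof.
case=> _ phiP Rx; have [t [/allP t1 -> ->]] := phiP x Rx.
rewrite -(big_map red xpredT (fun a => 'X - a%:P)) => /prod_XsubC_eq ts.
rewrite -(perm_big _ ts) big_map; apply: eq_big_seq => z /t1 uz.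
by rewrite red_unity_liftK ?(p'_order Rx).
Qed.

Lemma affords_red_trace phi x :
    affords_Brauer_char red rG phi -> x \in Greg ->
  phi x \in Aint /\ red (phi x) = \tr (rG x).
Proof.
case=> _ phiP Rx; have [t [/allP t1 charE ->]] := phiP x Rx.
have At z : z \in t -> z \in Aint by move/t1; apply: Aint_unity_root.
have Asum s : {subset s <= t} -> \sum_(z <- s) z \in Aint.
  by move=> sub_st; rewrite big_seq; apply: rpred_sum => z sz; apply: At
    (sub_st z sz).
split; first exact: Asum.
rewrite (mxtrace_split (s := map red t)); last by rewrite big_map.
have: {subset t <= t} by [].
elim: {-2}t => [|z s IHs] sub_st; first by rewrite !big_nil red0.
have sub_s : {subset s <= t} by move=> y sy; apply: sub_st; rewrite inE sy orbT.
by rewrite /= !big_cons -IHs // redD ?Asum ?At ?sub_st ?mem_head.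
Qed.

End OneRepresentation.

Lemma affords_uniq n1 n2 (rG1 : mx_representation F G n1)
    (rG2 : mx_representation F G n2) phi1 phi2 :
    affords_Brauer_char red rG1 phi1 -> affords_Brauer_char red rG2 phi2 ->
    {in Greg, forall x, char_poly (rG1 x) = char_poly (rG2 x)} ->
  phi1 = phi2.
Proof.
move=> aff1 aff2 eq_char; apply/cfunP=> x; have [Rx|R'x] := boolP (x \in Greg).
  rewrite (affords_unity_lift aff1 Rx (spectrumE _)).
  by rewrite (affords_unity_lift aff2 Rx (spectrumE _)) eq_char.
by case: aff1 aff2 => [on1 _] [on2 _]; rewrite !(cfun_on0 _ R'x).
Qed.

Lemma affords_rsim n1 n2 (rG1 : mx_representation F G n1)
    (rG2 : mx_representation F G n2) phi1 phi2 :
    affords_Brauer_char red rG1 phi1 -> affords_Brauer_char red rG2 phi2 ->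
  mx_rsim rG1 rG2 -> phi1 = phi2.
Proof.
move=> aff1 aff2 [B n12 freeB homB]; apply: (affords_uniq aff1 aff2) => x
  /p_regularP[Gx _].
move: rG2 B freeB homB {aff2}; rewrite -n12 => rG2 B; rewrite row_free_unit =>
  uB homB.
rewrite -(char_poly_conj (rG2 x) (mulmxV uB) (mulVmx uB)).
by rewrite -homB // mulmxK.
Qed.

Lemma affords_add n (rG : mx_representation F G n) U (modU : mxmodule rG U)
  phi1 phi2 :
    affords_Brauer_char red (submod_repr modU) phi1 ->
    affords_Brauer_char red (factmod_repr modU) phi2 ->
  affords_Brauer_char red rG (phi1 + phi2).
Proof.
case=> on1 P1 [on2 P2]; split=> [|x Rx]; first exact: rpredD.
have [[s1 [u1 c1 E1]] [s2 [u2 c2 E2]]] := (P1 x Rx, P2 x Rx).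
exists (s1 ++ s2); rewrite all_cat u1 u2 cfunE E1 E2 !big_cat /= -c1 -c2.
by split=> //; apply: char_poly_sub_fact; case/p_regularP: Rx.
Qed.

Lemma affords0 n (rG : mx_representation F G n) : n = 0%N ->
  affords_Brauer_char red rG 0.
Proof.
move=> n0; split=> [|x _]; first exact: rpred0.
exists [::]; rewrite !big_nil cfunE; split=> //.
by move: rG; rewrite n0 => rG; rewrite /char_poly det_mx00.
Qed.

(** Scale a nontrivial relation by a coefficient of largest absolute value, so that it lies over
    [vring] with one coefficient 1. Its reduction relates the traces of non-similar irreducible
    representations, so all coefficients reduce to 0, a contradiction. Traces at arbitrary elements
    are read at their p'-parts. *)
Lemma IBr_free (X : seq 'CF(G)) :
    uniq X ->
    (forall phi, phi \in X -> exists n (rG : mx_representation F G n),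
       mx_irreducible rG /\ affords_Brauer_char red rG phi) ->
  free X.
Proof.
move=> uniqX irrX; change (free (in_tuple X)); apply/freeP => c cX0.
apply: contrapT => /existsNP[i0 /eqP nzi0].
have exR (i : 'I_(size X)) : exists R : {n & mx_representation F G n},
    mx_irreducible (tagged R) /\ affords_Brauer_char red (tagged R) X`_i.
  have [n [rG [irrG affG]]] := irrX _ (mem_nth 0 (ltn_ord i)).
  by exists (Tagged (mx_representation F G) rG).
have [R /all_and2[irrR affR]] := fin_all_exists exR.
have [i1 nzi1 i1P] := vring_max_val red (P := xpredT) isT nzi0.
pose a i : vring red := Sub (c i / c i1) (i1P i isT).
have a1 : a i1 = 1 by apply: val_inj; rewrite /= divff.
suff a0 : vred (a i1) = 0 by move/eqP: a0; rewrite a1 rmorph1 oner_eq0.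
apply: (irr_trace_independent (rG := fun i => tagged (R i)) (c := fun i => vred
  (a i))) => //.
  move=> i j /(affords_rsim (affR i) (affR j)) /eqP.
  by rewrite nth_uniq // => /eqP/val_inj.
move=> x Gx; have Ry := p_regular_constt Gx; set y := x.`_p^' in Ry.
have trE i : \tr (tagged (R i) x) = \tr (tagged (R i) y).
  rewrite (mxtrace_split (spectrumE _)).
  by rewrite (char_poly_p_part _ (red_char red)) // -(mxtrace_split (spectrumE
    _)).
pose b (i : 'I_(size X)) : vring red := Sub (X`_i y) (Aint_vring red
  (affords_red_trace (affR i) Ry).1).
have bE i : vred (b i) = \tr (tagged (R i) x).
  have [Ab rb] := affords_red_trace (affR i) Ry.
  by rewrite vred_Aint //= rb trE.
under eq_bigr do rewrite -bE -rmorphM; rewrite -rmorph_sum.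
suff ->: \sum_i a i * b i = 0 by rewrite rmorph0.
apply: vval_inj; rewrite rmorph_sum rmorph0 /=.
have /(congr1 (fun phi : 'CF(G) => (c i1)^-1 * phi y)) := cX0.
rewrite sum_cfunE cfunE mulr0 mulr_sumr => E; rewrite -[RHS]E.
by apply: eq_bigr => i _; rewrite rmorphM /= cfunE mulrA [_^-1 * _]mulrC.
Qed.

End Brauer.

(** * Irreducible Brauer characters of a block *)

Section BlockBrauer.

Variables (p : nat) (F : closedFieldType) (red : p_reduction p F).
Variables (gT : finGroupType) (G : {group gT}) (e : 'M[F]_(gcard G)).
Local Notation IBr := (IBr_block red e).
Local Notation Greg := (p_regular p G).

(** By [IBr_free], a finite subset has at most dim CF(G) elements. Finiteness is what makes
    [IBr_block] a genuine enumeration. *)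
Lemma is_IBr_block_finite : cardinality.finite_set (is_IBr_block red e).
Proof.
apply: contrapT => /(cardinality.infinite_set_fset (\dim {:'CF(G)}).+1)[B BP].
apply/negP; rewrite -leqNgt.
have freeB : free (enum_fset B).
  apply: (IBr_free (red := red)); first exact: fset_uniq.
  by move=> phi /BP[n [rG [irrG _ affG]]]; exists n, rG.
by rewrite -(eqP freeB) dimvS ?subvf.
Qed.

Lemma mem_IBr_block phi : phi \in IBr <-> is_IBr_block red e phi.
Proof.
have -> : (phi \in IBr) = (phi \in cardinality.fset_set (is_IBr_block red e))
  by [].
rewrite (cardinality.in_fset_set is_IBr_block_finite).
by split; [move/classical_sets.set_mem | move/classical_sets.mem_set].
Qed.

Lemma IBr_block_uniq : uniq IBr. Proof. exact: fset_uniq. Qed.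

Lemma IBr_block_free : free IBr.
Proof.
apply: (IBr_free (red := red)) IBr_block_uniq _ => phi.
by move/mem_IBr_block => [n [rG [irrG _ affG]]]; exists n, rG.
Qed.

(** The coefficients count composition factors; [e] acts as the identity on submodules and
    quotients, so all factors lie in the block. *)
Lemma Brauer_decomposition n (rG : mx_representation F G n) phi :
    gring_op rG e = 1%:M -> affords_Brauer_char red rG phi ->
  exists d : 'I_(l_block red e) -> nat, phi = \sum_j (d j)%:R *: IBr`_j.
Proof.
move: phi; elim/mx_repr_ind: n / rG => n rG.
- move=> n0 phi _ aff; exists (fun=> 0%N); rewrite big1 => [|j _]; last by
  rewrite scale0r.
  by apply: (affords_uniq aff (affords0 red rG n0)).
- move=> irrG phi op1 aff; have IBr_phi : phi \in IBr.
    by apply/mem_IBr_block; exists n, rG.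
  have lt_j := IBr_phi; rewrite -index_mem in lt_j.
  exists (fun j => j == Ordinal lt_j); rewrite (bigD1 (Ordinal lt_j)) //= eqxx.
  by rewrite scale1r nth_index // big1 ?addr0 // => j /negPf->; rewrite scale0r.
move=> U modU IHU IHV phi op1 aff.
have affU := Brauer_char_affords red (submod_repr modU).
have affV := Brauer_char_affords red (factmod_repr modU).
have [d1 E1] := IHU _ (gring_op_submod modU op1) affU.
have [d2 E2] := IHV _ (gring_op_factmod modU op1) affV.
exists (fun j => d1 j + d2 j)%N.
rewrite (affords_uniq aff (affords_add affU affV)) // {1}E1 {1}E2 -big_split /=.
by apply: eq_bigr => j _; rewrite -scalerDl natrD.
Qed.

End BlockBrauer.

(** * Integral forms of ordinary representations and their reduction *)

Section Lattice.

Variables (p : nat) (F : closedFieldType) (red : p_reduction p F).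
Variables (gT : finGroupType) (G : {group gT}).
Variables (n : nat) (rho : mx_representation algC G n).

(* Among all choices of n rows of the matrices rho g, one whose determinant   *)
(* has maximal valuation is a basis of the lattice spanned by all the rows:   *)
(* by Cramer's rule the coordinates of any other row are quotients of such    *)
(* determinants.                                                              *)
Lemma repr_integral_form : exists2 P : 'M[algC]_n, P \in unitmx &
  exists rO : gT -> 'M[vring red]_n,
    {in G, forall g, map_mx (@vval _ _ _) (rO g) = P *m rho g *m invmx P}.
Proof.
pose X (f : {ffun 'I_n -> gT * 'I_n}) := \matrix_i row (f i).2 (rho (f i).1).
pose inG (f : {ffun 'I_n -> gT * 'I_n}) := [forall i, (f i).1 \in G].
have [||f /andP[/forallP Gf nz_f] maxf] := @vring_max_val _ _ red _ inG (fun f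
  => \det (X f)) [ffun i => (1%g, i)].
- by apply/forallP=> i; rewrite ffunE group1.
- have -> : X [ffun i => (1%g, i)] = 1%:M.
    by apply/row_matrixP=> i; rewrite rowK ffunE repr_mx1.
  by rewrite det1 oner_eq0.
have uX : X f \in unitmx by rewrite unitmxE unitfE.
have intX h r j : h \in G -> (row r (rho h) *m invmx (X f)) 0 j \in vring_pred
  red.
  move=> Gh; pose f' := [ffun i => if i == j then (h, r) else f i].
  have inGf' : inG f' by apply/forallP=> i; rewrite ffunE; case: eqP.
  suff -> : (row r (rho h) *m invmx (X f)) 0 j = \det (X f') / \det (X f) by
    apply: maxf.
  rewrite /invmx uX -scalemxAr mxE mulrC; congr (_ * _).
  rewrite (expand_det_row _ j) mxE; apply: eq_bigr => k _.
  rewrite [X f' j k]mxE ffunE eqxx /=; congr (_ * _).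
  rewrite [adjugate _ _ _]mxE; congr (_ * \det _); apply/matrixP=> a b.
  by rewrite !mxE ffunE eq_sym (negPf (neq_lift _ _)).
exists (X f) => //.
have intP g : g \in G -> forall i j, (X f *m rho g *m invmx (X f)) i j \in
  vring_pred red.
  move=> Gg i j; have -> : (X f *m rho g *m invmx (X f)) i j
      = (row (f i).2 (rho ((f i).1 * g)%g) *m invmx (X f)) 0 j.
    have -> : row (f i).2 (rho ((f i).1 * g)%g) = row i (X f *m rho g).
      by rewrite repr_mxM // !row_mul rowK.
    by rewrite -row_mul [RHS]mxE.
  by apply: intX; rewrite groupM.
exists (fun g => \matrix_(i, j) insubd 0 ((X f *m rho g *m invmx (X f)) i j)).
by move=> g Gg; apply/matrixP=> i j; rewrite mxE [X in vval X]mxE /vval insubdK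
  //; apply: intP.
Qed.

End Lattice.

Lemma gring_proj_gset (F : fieldType) (gT : finGroupType) (G : {group gT})
    (k k' : 'I_#|classes G|) :
  gring_proj (repr (enum_val k)) (gset_mx F G (enum_val k')) 0 0 = (k == k')%:R.
Proof.
have [x Gx xE] := imsetP (enum_valP k); have [y Gy yE] := imsetP (enum_valP k').
have rk : repr (enum_val k) \in enum_val k by rewrite (mem_repr_classes
  (enum_valP k)).
have rG : repr (enum_val k) \in G.
  by move: rk; rewrite {2}xE; apply: subsetP; apply: class_subG.
have subG z : z \in enum_val k' -> z \in G.
  by rewrite yE; apply: subsetP; apply: class_subG.
rewrite linear_sum summxE; have [kk'|nk] := eqVneq k k'.
  rewrite (bigD1 (repr (enum_val k))) -?kk' //= gring_projE // eqxx mxE eqxx.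
  rewrite big1 ?addr0 // => z /andP[kz nz]; rewrite gring_projE //.
    by rewrite eq_sym (negPf nz) mxE.
  by apply: subG; rewrite -kk'.
rewrite big1 // => z kz; rewrite /= gring_projE ?(subG z kz) //.
case: eqP => [rz|_]; last by rewrite mxE.
case/eqP: nk; apply: enum_val_inj.
by move: rk kz; rewrite rz xE yE => /class_eqP<- /class_eqP<-.
Qed.

Lemma gring_center_expansion (F : fieldType) (gT : finGroupType) (G : {group
  gT}) z :
    (z \in 'Z(group_ring F G))%MS ->
  z = \sum_(k < #|classes G|) gring_proj (repr (enum_val k)) z 0 0 *: gset_mx F
    G (enum_val k).
Proof.
rewrite -classg_base_center => /submxP[u uE].
have zE : z = \sum_(k < #|classes G|) u 0 k *: gset_mx F G (enum_val k).
  apply: (can_inj mxvecK); rewrite uE mulmx_sum_row linear_sum.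
  by apply: eq_bigr => k _; rewrite linearZ rowK.
rewrite {1}zE; apply: eq_bigr => k _; congr (_ *: _).
rewrite zE linear_sum summxE (bigD1 k) //= linearZ mxE gring_proj_gset eqxx
  mulr1.
rewrite big1 ?addr0 // => k' nk; rewrite linearZ mxE gring_proj_gset.
by rewrite eq_sym (negPf nk) mulr0.
Qed.

Section IrrReduction.

Variables (p : nat) (F : closedFieldType) (red : p_reduction p F).
Variables (gT : finGroupType) (G : {group gT}) (i : Iirr G).
Local Notation Greg := (p_regular p G).

(** Write the representation over [vring] and apply [vred] entrywise. Eigenvalues at a p-regular
    element are roots of unity and reduce one by one; a class sum is already the scalar omega over
    [vring], so it remains scalar after reduction. *)
Lemma irr_reduction : exists n (rG : mx_representation F G n),
  [/\ (n > 0)%N, affords_Brauer_char red rG ('1_Greg * 'chi_i)%R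
    & forall z, (z \in 'Z(group_ring F G))%MS ->
        gring_op rG z = (red_central_char red i z)%:M].
Proof.
have [P uP [rO rOE]] := repr_integral_form red 'Chi_i.
have vinj n m : injective (map_mx (@vval _ _ red) : 'M_(n, m) -> 'M_(n, m)).
  move=> A B /matrixP eqAB; apply/matrixP=> a b.
  by apply: vval_inj; have := eqAB a b; rewrite !mxE.
have rO_repr : mx_repr G (fun x => map_mx (vred (red := red)) (rO x)).
  split=> [|x y Gx Gy].
    suff ->: rO 1%g = 1%:M by rewrite map_mx1.
    by apply: vinj; rewrite rOE // repr_mx1 mulmx1 mulmxV // map_mx1.
  suff ->: rO (x * y)%g = rO x *m rO y by rewrite map_mxM.
  apply: vinj; rewrite map_mxM !rOE ?groupM // repr_mxM //.
  by rewrite !mulmxA mulmxKV.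
exists _, (MxRepresentation rO_repr); split.
- exact: irr_degree_gt0.
- split=> [|x Rx].
    apply/cfun_onP=> x R'x; rewrite cfunE cfuniE ?p_regular_normal ?(negPf R'x)
      ?mul0r //.
  have [Gx _] := p_regularP _ _ _ Rx.
  have [d [[B uB BE] [d1 _] [chiE _] _]] := repr_rsim_diag 'Chi_i Gx.
  exists [seq d 0 j | j <- enum 'I_(irr_degree (socle_of_Iirr i))]; split.
  + by apply/allP=> _ /mapP[j _ ->]; apply/unity_rootP.
  + have Ad j : d 0 j \in Aint.
      by apply: (@Aint_unity_root #[x]); rewrite ?order_gt0 //;
        apply/unity_rootP.
    pose dO j : vring red := Sub (d 0 j) (Aint_vring red (Ad j)).
    have charO : char_poly (rO x) = \prod_j ('X - (dO j)%:P).
      apply: (map_inj_poly (@vval_inj _ _ _)); first exact: rmorph0.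
      rewrite map_char_poly rOE // char_poly_conj ?mulmxV ?mulVmx // BE.
      rewrite char_poly_conj ?mulmxV ?mulVmx //.
      rewrite char_poly_trig ?diag_mx_is_trig // rmorph_prod.
      apply: eq_bigr => j _; rewrite mxE eqxx rmorphB /= map_polyX map_polyC.
      by [].
    rewrite -map_char_poly charO rmorph_prod /= big_map big_enum /=.
    apply: eq_bigr => j _; rewrite rmorphB /= map_polyX map_polyC /=.
    by have -> : vred (dO j) = red (d 0 j) by apply: vred_Aint; apply: Ad.
  rewrite cfunE cfuniE ?p_regular_normal // Rx mul1r -irrRepr chiE.
  by rewrite big_map big_enum.
move=> z Zz; rewrite {1}(gring_center_expansion Zz) linear_sum.
rewrite /red_central_char rmorph_sum; apply: eq_bigr => k _.
rewrite linearZ /= scalar_mxM mul_scalar_mx; congr (_ *: _).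
have Aw := Aint_gring_mode_class_sum i k.
pose w : vring red := Sub 'omega_i['K_k] (Aint_vring red Aw).
have kG x : x \in enum_val k -> x \in G.
  by have [y Gy ->] := imsetP (enum_valP k); apply: subsetP; apply: class_subG.
have sumO : \sum_(x in enum_val k) rO x = w%:M.
  apply: vinj; rewrite map_scalar_mx [map_mx _ _]raddf_sum /=.
  have := irr_gring_center i (gring_class_sum_central algC k).
  rewrite linear_sum => kE; rewrite [vval w]/('omega_i['K_k]).
  transitivity (P *m ('omega_i['K_k])%:M *m invmx P); last first.
    by rewrite mul_mx_scalar -scalemxAl mulmxV // scalemx1.
  rewrite -kE mulmx_sumr mulmx_suml; apply: eq_bigr => x /kG Gx.
  by rewrite rOE //= gring_opG.
have -> : red 'omega_i['K_k] = vred w by rewrite vred_Aint.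
rewrite -map_scalar_mx -sumO [LHS]linear_sum [RHS]raddf_sum; apply: eq_bigr =>
  x /kG Gx.
by rewrite /= gring_opG.
Qed.

End IrrReduction.

(** * Connectedness of the decomposition matrix *)

Lemma center_mulmx (F : fieldType) m n (R : 'A[F]_(m, n)) A B :
  (forall A B : 'M_n, A \in R -> B \in R -> A *m B \in R)%MS ->
  (A \in 'Z(R) -> B \in 'Z(R) -> A *m B \in 'Z(R))%MS.
Proof.
move=> mulR /center_mxP[RA cA] /center_mxP[RB cB]; apply/center_mxP.
split=> [|C RC]; first exact: mulR.
by rewrite mulmxA cA // -!mulmxA cB.
Qed.

Section Block.

Variables (p : nat) (F : closedFieldType) (red : p_reduction p F).
Variables (gT : finGroupType) (G : {group gT}).
Local Notation Greg := (p_regular p G).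
Local Notation aG := (regular_repr F G).
Local Notation R_G := (group_ring F G).

(** These are the scalars by which central elements act on a reduction of ['chi_i], and [gring_op]
    is multiplicative. *)
Lemma red_central_charM (i : Iirr G) A B : (A \in 'Z(R_G))%MS -> (B \in
  'Z(R_G))%MS ->
  red_central_char red i (A *m B) = red_central_char red i A * red_central_char
    red i B.
Proof.
move=> ZA ZB; have [n [rG [n_gt0 _ opE]]] := irr_reduction red i.
have ZAB : (A *m B \in 'Z(R_G))%MS by apply: center_mulmx => // *; apply:
  envelop_mxM.
have [RB _] := center_mxP ZB.
have := gring_opM rG A RB; rewrite !opE // -scalar_mxM => /matrixP/(_ (Ordinal
  n_gt0) (Ordinal n_gt0)).
by rewrite !mxE eqxx.
Qed.

Lemma red_central_char_gring_op (i : Iirr G) A : (A \in 'Z(R_G))%MS ->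
  exists n (rG : mx_representation F G n), [/\ (n > 0)%N,
    affords_Brauer_char red rG ('1_Greg * 'chi_i)%R
    & gring_op rG A = (red_central_char red i A)%:M].
Proof.
by move=> ZA; have [n [rG [n_gt0 aff opE]]] := irr_reduction red i; exists n,
  rG; rewrite opE.
Qed.

Lemma red_central_char1 (i : Iirr G) : red_central_char red i 1%:M = 1.
Proof.
have Z1 : (1%:M \in 'Z(R_G))%MS.
  by apply/center_mxP; split=> [|A _]; rewrite ?envelop_mx1 // mulmx1 mul1mx.
have [n [rG [n_gt0 _]]] := red_central_char_gring_op i Z1.
rewrite gring_op1 => /matrixP/(_ (Ordinal n_gt0) (Ordinal n_gt0)).
by rewrite !mxE eqxx.
Qed.

(** Otherwise the difference of the two equal traces would be a nontrivial relation against
    [irr_trace_independent]; the coefficients are 1 and -1. *)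
Lemma Brauer_char_inj n1 n2 (rG1 : mx_representation F G n1)
    (rG2 : mx_representation F G n2) phi :
    mx_irreducible rG1 -> mx_irreducible rG2 ->
    affords_Brauer_char red rG1 phi -> affords_Brauer_char red rG2 phi ->
  mx_rsim rG1 rG2.
Proof.
move=> irr1 irr2 aff1 aff2; apply: contrapT => nsim.
pose rG b := if b return mx_representation F G (if b then n1 else n2) then rG1
  else rG2.
have c0: forall b : bool, (-1) ^+ b = 0 :> F.
  apply: (@irr_trace_independent _ _ _ _ _ rG (fun b : bool => (-1) ^+ b)).
  - by case.
  - by case=> -[] //= /mx_rsim_sym.
  move=> x Gx; rewrite big_bool /= mulN1r mul1r.
  have trE n (r : mx_representation F G n) : affords_Brauer_char red r phi ->
      \tr (r x) = red (phi x.`_p^').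
    move=> aff; have [_ ->] := affords_red_trace aff (p_regular_constt p Gx).
    rewrite (mxtrace_split (spectrumE _)).
    by rewrite (char_poly_p_part _ (red_char red)) // -(mxtrace_split
      (spectrumE _)).
  by rewrite (trE _ rG1) // (trE _ rG2) // addNr.
by have /eqP := c0 false; rewrite oner_eq0.
Qed.

(** On a Sylow p-subgroup P, [psi] vanishes off 1, so psi(1) / |P| is its multiplicity of the
    trivial character. *)
Lemma vanishing_degree_int (psi : 'CF(G)) :
    psi \in 'Z[irr G] -> {in G :\: Greg, forall y, psi y = 0} ->
  psi 1%g / (#|G| `_p)%:R \in Num.int.
Proof.
move=> Zpsi psi0; have [P sylP] := Sylow_exists p G.
have [sPG pP _] := and3P sylP.
have := Cint_cfdot_vchar_irr 0 (cfRes_vchar P Zpsi).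
rewrite irr0 cfdotE (bigD1 1%g) //= big1 => [|x /andP[Px nx]].
  by rewrite addr0 cfResE // cfun1E group1 rmorph1 mulr1 (card_Hall sylP) mulrC.
rewrite cfResE // psi0 ?mul0r // !inE (subsetP sPG) // andbT.
apply/negP => p'x; case/eqP: nx; apply/eqP; rewrite -order_eq1; apply/eqP.
exact: pnat_1 (mem_p_elt pP Px) p'x.
Qed.

Variables (e : 'M[F]_(gcard G)).
Hypothesis blk : block_idempotent e.
Local Notation k := (k_block red e).
Local Notation l := (l_block red e).
Local Notation D := (decomposition_mx red e).
Local Notation IBr := (IBr_block red e).

Let Ze : (e \in 'Z(R_G))%MS. Proof. by case: blk => [[]]. Qed.
Let ee : e *m e = e. Proof. by case: blk => [[]]. Qed.

Lemma red_central_char_block (i : Iirr G) :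
  red_central_char red i e = (i \in Irr_block red e)%:R.
Proof.
rewrite inE; have := red_central_charM i Ze Ze; rewrite ee => /eqP.
rewrite -subr_eq0 -{1}[red_central_char _ _ _]mulr1 -mulrBr mulf_eq0 =>
  /orP[/eqP-> | ].
  by rewrite eq_sym oner_eq0.
by rewrite subr_eq0 => /eqP <-; rewrite eqxx.
Qed.

Lemma block_span (i : Iirr G) : i \in Irr_block red e ->
  exists d : 'I_l -> nat, '1_Greg * 'chi_i = \sum_j (d j)%:R *: IBr`_j.
Proof.
move=> Bi; have [n [rG [_ aff]]] := red_central_char_gring_op i Ze.
by rewrite red_central_char_block Bi => /Brauer_decomposition/(_ aff).
Qed.

Lemma decompositionP (i : 'I_k) :
  (forall j, D i j \in Num.nat) /\
  '1_Greg * 'chi_(enum_val i) = \sum_j D i j *: IBr`_j.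
Proof.
have [d dE] := block_span (enum_valP i).
have DE j : D i j = (d j)%:R.
  rewrite mxE dE; apply: (@coord_sum_free _ _ _ (in_tuple IBr) (fun j => (d
    j)%:R) j).
  exact: (IBr_block_free red e).
by split=> [j|]; rewrite ?DE ?natr_nat // dE; apply: eq_bigr => j _; rewrite DE.
Qed.

(** For p-singular y, the sum of chi(y) chi over all chi vanishes on p-regular elements by column
    orthogonality. The parts inside and outside the block lie in the independent spans of disjoint
    sets of irreducible Brauer characters, so each part is 0. *)
Lemma block_orthogonality y j : y \in G :\: Greg ->
  \sum_i D i j * 'chi_(enum_val i) y = 0.
Proof.
case/setDP=> Gy R'y; pose e' := 1%:M - e.
(* The idempotent [e'] gathers all other blocks at once; [IBr_block] makes sense for it all the
   same. *)
have Ze' : (e' \in 'Z(R_G))%MS.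
  apply/center_mxP; have [Re cGe] := center_mxP Ze; split=> [|A RA].
    by rewrite linearB addmx_sub ?envelop_mx1 ?eqmx_opp.
  by rewrite mulmxBl mulmxBr mulmx1 mul1mx cGe.
have free_cat : free (IBr ++ IBr_block red e').
  apply: (IBr_free (red := red)).
    rewrite cat_uniq !IBr_block_uniq andbT; apply/hasPn => phi.
    move=> /(mem_IBr_block red e')[n2 [rG2 [irr2 op2 aff2]]].
    apply/negP=> /(mem_IBr_block red e)[n1 [rG1 [irr1 op1 aff1]]].
    have := gring_op_rsim (Brauer_char_inj irr1 irr2 aff1 aff2) op1.
    move: op2; rewrite linearB /= gring_op1 => op2 op1'.
    have [n_gt0 _] := (mx_irrP _).1 irr2; move: op2; rewrite op1' subrr.
    move/matrixP/(_ (Ordinal n_gt0) (Ordinal n_gt0)); rewrite !mxE eqxx => /eqP.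
    by rewrite eq_sym oner_eq0.
  move=> phi; rewrite mem_cat => /orP[].
    by move=> /mem_IBr_block[n [rG [irrG _ aff]]]; exists n, rG.
  by move=> /mem_IBr_block[n [rG [irrG _ aff]]]; exists n, rG.
have := free_cat; rewrite cat_free => /and3P[freeB _ /directv_addP dxBB'].
pose W := \sum_(i | i \notin Irr_block red e) 'chi_i y *: ('1_Greg * 'chi_i).
have WB' : W \in <<IBr_block red e'>>%VS.
  apply: rpred_sum => i B'i; apply: rpredZ.
  have [n [rG [_ aff opE]]] := red_central_char_gring_op i Ze'.
  have op1 : gring_op rG e' = 1%:M.
    have [n1 [rG1 [_ aff1 opE1]]] := red_central_char_gring_op i Ze.
    rewrite opE; congr (_%:M).
    have -> : red_central_char red i e' = red_central_char red i 1%:M -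
      red_central_char red i e.
      rewrite /red_central_char -sumrB; apply: eq_bigr => a _.
      by rewrite -mulrBl linearB !mxE.
    by rewrite red_central_char1 red_central_char_block (negPf B'i) subr0.
  have [d ->] := Brauer_decomposition op1 aff.
  by apply: rpred_sum => a _; apply: rpredZ; apply: memv_span; apply: mem_nth.
pose V := \sum_j (\sum_i D i j * 'chi_(enum_val i) y) *: IBr`_j.
have VW0 : V + W = 0.
  have -> : V + W = \sum_i 'chi_i y *: ('1_Greg * 'chi_i).
    rewrite [RHS](bigID (mem (Irr_block red e))) /=; congr (_ + _).
    rewrite big_enum_val /V /=; under eq_bigr do rewrite scaler_suml.
    rewrite exchange_big; apply: eq_bigr => i _ /=.
    rewrite (decompositionP i).2 scaler_sumr; apply: eq_bigr => a _.
    by rewrite scalerA mulrC.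
  apply/cfunP=> x; rewrite sum_cfunE cfunE.
  under eq_bigr do rewrite !cfunE cfuniE ?p_regular_normal // mulrCA [_ * 'chi_
    _ x]mulrC.
  rewrite -mulr_sumr; have [Rx|] := boolP (x \in Greg); last by rewrite mul0r.
  rewrite mul1r (eq_bigr (fun i => 'chi_i x * ('chi_i y^-1%g)^*)) => [|i _];
    last first.
    by rewrite -irr_inv invgK.
  rewrite second_orthogonality_relation ?groupV //; case: imsetP => // -[z Gz
    xE].
  case/negP: R'y; have := Rx; rewrite xE p_regularJ // !inE groupV.
  by rewrite /p_elt orderV.
have V0 : V = 0.
  apply/eqP; rewrite -memv0 -dxBB' memv_cap; apply/andP; split.
    by apply: rpred_sum => a _; apply: rpredZ; apply: memv_span; apply: mem_nth.
  by rewrite (canRL (addrK _) VW0) sub0r rpredN.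
have freeI : free (in_tuple IBr) by [].
by move/freeP: freeI => /(_ _ V0 j).
Qed.

Lemma l_block_gt0 : (0 < k)%N -> (0 < l)%N.
Proof.
move=> k_gt0; pose i := Ordinal k_gt0; rewrite lt0n; apply/eqP => l0.
have := (decompositionP i).2; rewrite big1 => [|j _]; last first.
  by exfalso; have := leq_ltn_trans (leq0n j) (ltn_ord j); rewrite l0.
move/cfunP/(_ 1%g)/eqP; rewrite !cfunE cfuniE ?p_regular_normal //.
by rewrite inE group1 /p_elt order1 mul1r (negPf (irr1_neq0 _)).
Qed.

(** * The central idempotent attached to a splitting of the decomposition matrix *)

Section Connected.

Variables (J : {set 'I_k}) (E : 'M[algC]_l).
Hypothesis EJ : {in J, forall i, row i D *m E = row i D}.
Hypothesis EJ' : {in ~: J, forall i, row i D *m E = 0}.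

Let theta j : 'CF(G) := \sum_(i in J) D i j *: 'chi_(enum_val i).

(** Multiply the row form of [block_orthogonality] by [E]: only the rows in [J] survive,
    unchanged. *)
Lemma theta_vanish j : {in G :\: Greg, forall y, theta j y = 0}.
Proof.
move=> y Gy; have rowD0 : \sum_i 'chi_(enum_val i) y *: row i D = 0.
  apply/rowP=> a; rewrite summxE mxE -[RHS](block_orthogonality a Gy).
  by apply: eq_bigr => i _; rewrite !mxE mulrC.
have /rowP/(_ j) : \sum_(i in J) 'chi_(enum_val i) y *: row i D = 0.
  have := congr1 (mulmx^~ E) rowD0; rewrite /= mul0mx => {}rowD0.
  apply: etrans rowD0; rewrite mulmx_suml [RHS](bigID (mem J)) /=.
  rewrite [X in _ = _ + X]big1 ?addr0 => [|i J'i]; last first.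
    by rewrite -scalemxAl EJ' ?scaler0 // inE.
  by apply: eq_big => // i Ji; rewrite -scalemxAl EJ.
rewrite summxE => E0; apply: etrans (etrans E0 _); last by rewrite mxE.
rewrite sum_cfunE; apply: eq_bigr => i _.
by rewrite cfunE [RHS]mxE [X in _ = _ * X]mxE mulrC.
Qed.

Lemma theta_degree j : theta j 1%g / (#|G| `_p)%:R \in Num.int.
Proof.
apply: vanishing_degree_int (@theta_vanish j).
apply: rpred_sum => i _; have [/(_ j)/natrP[m ->] _] := decompositionP i.
by rewrite scaler_nat rpredMn ?irr_vchar.
Qed.

(* The coefficient at x of the sum of the idempotents e_chi for chi in J.     *)
Definition block_part_coef x : algC :=
  #|G|%:R^-1 * \sum_(i in J) 'chi_(enum_val i) 1%g * 'chi_(enum_val i) x^-1%g.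
Local Notation c := block_part_coef.

Lemma block_irrE (i : 'I_k) x : x \in Greg ->
  'chi_(enum_val i) x = \sum_j D i j * IBr`_j x.
Proof.
move=> Rx; have /cfunP/(_ x) := (decompositionP i).2.
rewrite cfunE cfuniE ?p_regular_normal // Rx mul1r => ->.
by rewrite sum_cfunE; apply: eq_bigr => j _; rewrite cfunE.
Qed.

Lemma p_regular1 : 1%g \in Greg.
Proof. by rewrite inE group1 /p_elt order1. Qed.

Lemma p_regularV x : (x^-1%g \in Greg) = (x \in Greg).
Proof. by rewrite !inE groupV /p_elt orderV. Qed.

Lemma thetaE j x : theta j x = \sum_(i in J) D i j * 'chi_(enum_val i) x.
Proof. by rewrite sum_cfunE; apply: eq_bigr => i _; rewrite cfunE. Qed.

Lemma IBr_block_Aint x j : (j < l)%N -> x \in Greg -> IBr`_j x \in Aint.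
Proof.
move=> ltj Rx; have /mem_IBr_block[n [rG [_ _ aff]]] : IBr`_j \in IBr by apply:
  mem_nth.
by have [] := affords_red_trace aff Rx.
Qed.

(** If x is p-singular, expanding chi(1) on IBr(B) exhibits values theta_j(x^-1) = 0. If x is
    p-regular, expanding chi(x^-1) instead leaves theta_j(1) / |G|, whose p-part cancels by
    [theta_degree]. *)
Lemma block_part_coef_vring x : x \in G -> c x \in vring_pred red.
Proof.
move=> Gx; have [Rx|R'x] := boolP (x \in Greg); last first.
  suff -> : c x = 0 by apply: rpred0.
  rewrite /c; under eq_bigr do rewrite (block_irrE _ p_regular1) mulr_suml.
  rewrite exchange_big big1 ?mulr0 //= => j _.
  under eq_bigr do rewrite mulrAC.
  rewrite -mulr_suml -thetaE theta_vanish ?mul0r //.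
  by rewrite in_setD p_regularV R'x groupV.
have -> : c x = \sum_(j < l) IBr`_j x^-1%g *
    (theta j 1%g / (#|G| `_p)%:R * ((#|G| `_(p^'))%:R)^-1).
  rewrite /c mulr_sumr.
  under eq_bigr => i _ do rewrite (block_irrE i (etrans (p_regularV x) Rx))
    !mulr_sumr.
  rewrite exchange_big; apply: eq_bigr => j _ /=.
  rewrite thetaE !mulr_suml mulr_sumr; apply: eq_bigr => i _.
  rewrite -{1}(partnC p (cardG_gt0 G)) natrM invfM.
  by ring.
have gG : (0 < #|G|)%N := cardG_gt0 G.
apply: rpred_sum => j _; apply: rpredM.
  by apply: Aint_vring; apply: IBr_block_Aint; rewrite ?p_regularV.
apply: rpredM; first by apply/Aint_vring/Aint_Cint/theta_degree.
apply/vringP; exists 1, (#|G| `_(p^'))%:R.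
rewrite Aint1 rpred_nat red_nat div1r; split=> //.
rewrite -(dvdn_pcharf (red_char red)) -p'natE ?part_pnat //.
exact: pcharf_prime (red_char red).
Qed.

Definition block_part_coefO x : vring red := insubd 0 (c x).
Local Notation cO := block_part_coefO.

Lemma block_part_coefOE x : x \in G -> vval (cO x) = c x.
Proof. by move=> Gx; rewrite /vval insubdK // block_part_coef_vring. Qed.

Lemma block_part_coefJ x y : y \in G -> c (x ^ y)%g = c x.
Proof.
by move=> Gy; congr (_ * _); apply: eq_bigr => i _; rewrite -conjVg cfunJ.
Qed.

(** Idempotency before reduction: the e_chi are orthogonal idempotents. *)
Lemma block_part_coef_conv z : z \in G ->
  \sum_(x in G) c x * c (x^-1 * z)%g = c z.
Proof.
move=> Gz; rewrite /c.
transitivity (\sum_(i in J) \sum_(a in J) #|G|%:R^-1 * ('chi_(enum_val i) 1%g *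
  'chi_(enum_val a) 1%g) *
   (#|G|%:R^-1 * \sum_(x in G) 'chi_(enum_val a) (x * z^-1)%g * 'chi_(enum_val
     i) x^-1%g)).
  under [RHS]eq_bigr => i _.
    under eq_bigr => a _ do rewrite mulrA mulr_sumr.
    rewrite exchange_big; over.
  rewrite [RHS]exchange_big; apply: eq_bigr => x Gx /=.
  rewrite mulrACA big_distrlr /= mulr_sumr; apply: eq_bigr => i _.
  rewrite mulr_sumr; apply: eq_bigr => a _.
  have -> : 'chi_(enum_val a) (x^-1 * z)^-1%g = 'chi_(enum_val a) (x * z^-1)%g.
    by rewrite invMg invgK -[RHS](cfunJ _ _ Gx) conjgE !mulgA mulVg mul1g.
  by ring.
rewrite mulr_sumr; apply: eq_bigr => i Ji.
rewrite (bigD1 i) //= [X in _ + X]big1 => [|a /andP[_ nai]]; last first.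
  by rewrite generalized_orthogonality_relation (inj_eq enum_val_inj) (negPf
    nai) mul0r mulr0.
rewrite addr0 generalized_orthogonality_relation eqxx mul1r.
have nz := irr1_neq0 (enum_val i).
by rewrite -!mulrA; congr (_ * (_ * _)); rewrite mulrCA divff ?mulr1.
Qed.

(** The central character of ['chi_i] at the sum of the e_chi over [J]. *)
Lemma block_part_coef_irr (i : Iirr G) :
  ('chi_i 1%g)^-1 * \sum_(x in G) c x * 'chi_i x
    = (i \in [set enum_val a | a in J])%:R.
Proof.
transitivity (\sum_(a in J) 'chi_(enum_val a) 1%g / 'chi_i 1%g *
    (#|G|%:R^-1 * \sum_(x in G) 'chi_i x * 'chi_(enum_val a) x^-1%g)).
  rewrite /c; under [RHS]eq_bigr => a _ do rewrite mulrA mulr_sumr.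
  rewrite exchange_big mulr_sumr; apply: eq_bigr => x _ /=.
  rewrite !mulr_sumr mulr_suml mulr_sumr; apply: eq_bigr => a _.
  by ring.
under eq_bigr do rewrite first_orthogonality_relation.
case: imsetP => [[a Ja ->]|J'i].
  rewrite (bigD1 a) //= eqxx mulr1 divff ?irr1_neq0 // big1 ?addr0 // => b
    /andP[_ nba].
  by rewrite (inj_eq enum_val_inj) eq_sym (negPf nba) mulr0.
rewrite big1 // => a Ja; case: eqP => [iE|_]; last by rewrite mulr0.
by case: J'i; exists a.
Qed.

Definition block_part_idempotent : 'M[F]_(gcard G) :=
  \sum_(x in G) vred (cO x) *: aG x.
Local Notation f := block_part_idempotent.

Lemma block_part_center : (f \in 'Z(R_G))%MS.
Proof.
have Rf : (f \in R_G)%MS by apply/envelop_mxP; exists (fun x => vred (cO x)).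
apply/center_mxP; split=> // A /envelop_mxP[a ->].
rewrite mulmx_suml mulmx_sumr; apply: eq_bigr => g Gg.
rewrite -scalemxAl -scalemxAr; congr (_ *: _).
rewrite mulmx_suml mulmx_sumr [RHS](reindex_inj (conjg_inj g^-1%g)) /=.
apply: eq_big => [x|x Gx]; first by rewrite groupJr ?groupV.
rewrite -scalemxAl -scalemxAr -!repr_mxM ?groupJ ?groupV //.
have -> : (x ^ g^-1 * g = g * x)%g by rewrite conjgE invgK !mulgA mulgKV.
congr (vred _ *: _); apply: vval_inj.
by rewrite !block_part_coefOE ?groupJ ?groupV // block_part_coefJ ?groupV.
Qed.

Lemma block_part_idempotentP : f *m f = f.
Proof.
rewrite {1}/f mulmx_suml.
have -> : \sum_(x in G) vred (cO x) *: aG x *m f =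
    \sum_(x in G) \sum_(z in G) (vred (cO x) * vred (cO (x^-1 * z)%g)) *: aG z.
  apply: eq_bigr => x Gx; rewrite mulmx_sumr (reindex_inj (mulgI x^-1%g)) /=.
  apply: eq_big => [z|z]; rewrite groupMl ?groupV // => Gz.
  by rewrite -scalemxAl -scalemxAr scalerA -repr_mxM ?groupM ?groupV // mulKVg.
rewrite exchange_big; apply: eq_bigr => z Gz /=; rewrite -scaler_suml.
congr (_ *: _); under eq_bigr do rewrite -rmorphM.
rewrite -rmorph_sum; congr vred; apply: vval_inj.
rewrite rmorph_sum block_part_coefOE // -[RHS]block_part_coef_conv //.
by apply: eq_bigr => x Gx; rewrite rmorphM /= !block_part_coefOE // groupM
  ?groupV.
Qed.

Lemma block_part_central_char (i : Iirr G) :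
  red_central_char red i f = (i \in [set enum_val a | a in J])%:R.
Proof.
have rG (k : 'I_#|classes G|) : repr (enum_val k) \in enum_val k /\ repr
  (enum_val k) \in G.
  have rk := mem_repr_classes (enum_valP k); split=> //.
  have [x Gx xE] := imsetP (enum_valP k); move: rk; rewrite {2}xE.
  by apply: subsetP; apply: class_subG.
have projf x : x \in G -> gring_proj x f 0 0 = vred (cO x).
  move=> Gx; rewrite linear_sum summxE (bigD1 x) //= linearZ /= gring_projE //
    eqxx.
  rewrite scalemx1 mxE eqxx mulr1n big1 ?addr0 // => y /andP[Gy nyx].
  by rewrite linearZ /= gring_projE // eq_sym (negPf nyx) scaler0 mxE.
pose w (k : 'I_#|classes G|) : vring red :=
  Sub 'omega_i['K_k] (Aint_vring red (Aint_gring_mode_class_sum i k)).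
rewrite /red_central_char.
transitivity (vred (\sum_(k < #|classes G|) cO (repr (enum_val k)) * w k)).
  rewrite rmorph_sum; apply: eq_bigr => k _; have [_ Gr] := rG k.
  rewrite rmorphM projf //; congr (_ * _); symmetry; apply: vred_Aint.
  exact: Aint_gring_mode_class_sum.
rewrite -(rmorph_nat (vred (red := red))); congr vred; apply: vval_inj.
rewrite rmorph_nat -block_part_coef_irr rmorph_sum sum_by_classes; last first.
  by move=> x y Gx Gy; rewrite block_part_coefJ // cfunJ.
rewrite mulr_sumr [RHS]big_enum_val; apply: eq_bigr => k _; have [rk Gr] := rG
  k.
have wE : vval (w k) = #|repr (enum_val k) ^: G|%:R * 'chi_i (repr (enum_val
  k)) / 'chi_i 1%g.
  by rewrite -(gring_mode_class_sum_eq i rk).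
rewrite rmorphM /= block_part_coefOE // wE.
have [x Gx xE] := imsetP (enum_valP k).
have -> : repr (enum_val k) ^: G = enum_val k by move: rk; rewrite xE =>
  /class_eqP ->.
by ring.
Qed.

(** The central idempotent f e lies under [e], so it is 0 or [e]. On the characters of the block its
    central character values are the indicator of [J]. *)
Lemma block_part_trivial : J = set0 \/ J = setT.
Proof.
have [_ _ prim_e] := blk.
have Zf := block_part_center; have ff := block_part_idempotentP.
have [Rf cf] := center_mxP Zf; have [Re ce] := center_mxP Ze.
have Zfe : (f *m e \in 'Z(R_G))%MS by apply: center_mulmx => // *; apply:
  envelop_mxM.
have charE (a : 'I_k) : red_central_char red (enum_val a) (f *m e) = (a \in
  J)%:R.
  rewrite red_central_charM // red_central_char_block enum_valP mulr1.
  rewrite block_part_central_char; congr (_%:R); congr nat_of_bool.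
  by apply/imsetP/idP => [[b Jb /enum_val_inj ->]|Ja] //; exists a.
have [||fe0|fee] := prim_e (f *m e).
- by split=> //; rewrite -mulmxA (mulmxA e) cf // -(mulmxA f) ee mulmxA ff.
- by rewrite -mulmxA ee.
- left; apply/setP=> a; rewrite inE; apply/negP => Ja.
  have := charE a; rewrite Ja fe0 /red_central_char big1 => [/eqP|b _].
    by rewrite eq_sym oner_eq0.
  by rewrite linear0 mxE mul0r.
right; apply/setP=> a; rewrite inE; apply: contraT => J'a.
have := charE a; rewrite (negPf J'a) fee red_central_char_block enum_valP.
by move/eqP; rewrite oner_eq0.
Qed.

End Connected.
End Block.

(** * Existence of reductions *)

(** Zorn's lemma; maximality is phrased as invertibility modulo the ideal, ready for the quotient
    field. *)
Lemma maximal_ideal_exists (R : comNzRingType) (a : R) :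
    (forall b, a * b <> 1) ->
  exists M : idealr R, a \in M /\ forall x, x \notin M -> exists y, 1 - x * y
    \in M.
Proof.
move=> nu_a.
pose isI (A : classical_sets.set R) := [/\ A a, ~ A 1 &
  forall c u v, A u -> A v -> A (c * u + v)].
pose P (A : classical_sets.set R) := (forall x, ~ A x) \/ isI A.
have P_in A x : P A -> A x -> isI A by case=> // /(_ x).
have [C CP totC|M [PM maxM]] := @classical_sets.Zorn_bigcup R P.
  have [[A CA [x Ax]]|nC] := pselect (exists2 A, C A & exists x, A x).
    right; have [Aa A1 _] := P_in A x (CP A CA) Ax; split; first by exists A.
      by case=> B CB B1; have [_ nB1 _] := P_in B 1 (CP B CB) B1.
    move=> c u v [B1 CB1 B1u] [B2 CB2 B2v].
    have [s|s] := totC _ _ CB1 CB2.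
      have [_ _ cl] := P_in _ _ (CP _ CB2) B2v.
      by exists B2 => //; apply: cl => //; apply: s.
    have [_ _ cl] := P_in _ _ (CP _ CB1) B1u.
    by exists B1 => //; apply: cl => //; apply: s.
  by left=> x [A CA Ax]; apply: nC; exists A => //; exists x.
have [Ma M1 clM] : isI M.
  case: PM => // M0; pose aR : classical_sets.set R := fun x => exists b, x = a
    * b.
  have aRa : aR a by exists 1; rewrite mulr1.
  case: (maxM aR).
    by split; [move=> x /M0 | move=> /(_ _ aRa)/M0].
  right; split=> // [[b /esym/nu_a] | c _ _ [u ->] [v ->]] //.
  by exists (c * u + v); rewrite mulrDr mulrCA.
pose Mb : {pred R} := fun x => `[<M x>].
have M0 : M 0 by rewrite -[0](addNr a) -mulN1r; apply: clM.
have cM : idealr_closed Mb.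
  split; [exact/asboolP | exact/asboolPn | ].
  by move=> c u v /asboolP Mu /asboolP Mv; apply/asboolP/clM.
pose I : idealr R := HB.pack Mb (isIdealr.Build R Mb cM).
exists I; split=> [|x M'x]; first exact/asboolP.
have {}M'x : ~ M x by move/asboolP: M'x.
pose N : classical_sets.set R := fun z => exists2 m, M m & exists y, z = m + x
  * y.
have Nx : N x by exists 0 => //; exists 1; rewrite add0r mulr1.
have [[m Mm [y E1]]|N1] := pselect (N 1).
  by exists y; apply/asboolP; rewrite E1 addrK.
case: (maxM N).
  split=> [z Mz|/(_ x Nx)//]; by exists z => //; exists 0; rewrite mulr0 addr0.
right; split=> //; first by exists a => //; exists 0; rewrite mulr0 addr0.
move=> c _ _ [m Mm [y ->]] [m' Mm' [y' ->]].
exists (c * m + m'); first exact: clM.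
by exists (c * y + y'); ring.
Qed.

(** A monic equation over the quotient lifts to a monic equation over [R], and a root there projects
    to a root. *)
Lemma maximal_quotient_closed (R : comNzRingType) (M : idealr R) :
    (forall x, x \notin M -> exists y, 1 - x * y \in M) ->
    (forall n (P : nat -> R), (n > 0)%N ->
       exists x, x ^+ n = \sum_(i < n) P i * x ^+ i) ->
  exists (F : closedFieldType) (f : {rmorphism R -> F}), {in M, forall x, f x =
    0}.
Proof.
move=> maxM closedR; pose K := {ideal_quot M}.
pose pi : {rmorphism R -> K} := \pi_K%qT.
have pi0 x : (pi x == 0) = (x \in M).
  by rewrite -[0]/(0 : K) -(rmorph0 pi) -Quotient.idealrBE subr0.
have pi_surj (x : K) : exists z, pi z = x.
  by exists (generic_quotient.repr x); apply: generic_quotient.reprK.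
have exV (x : K) : exists y, (x != 0 -> y * x = 1) /\ (x = 0 -> y = 0).
  have [z <-] := pi_surj x; have [z0|nz] := eqVneq (pi z) 0.
    by exists 0; split=> // /eqP[].
  have [|y My] := maxM z; first by rewrite -pi0.
  exists (pi y); split=> [_|z0]; last by rewrite z0 eqxx in nz.
  by apply/eqP; rewrite -subr_eq0 -rmorphM -(rmorph1 pi) -rmorphB pi0 -rpredN
    opprB mulrC.
pose inv x := sval (cid (exV x)).
have mulVf x : x != 0 -> inv x * x = 1 by case: (svalP (cid (exV x))).
have inv0 : inv 0 = 0 by case: (svalP (cid (exV 0))) => _; apply.
pose Kf : fieldType := HB.pack K (GRing.ComNzRing_isField.Build K mulVf inv0).
have closedK : GRing.closed_field_axiom Kf.
  move=> n P n_gt0; pose Q i := sval (cid (pi_surj (P i))).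
  have [x xE] := closedR n Q n_gt0; exists (pi x).
  rewrite -[LHS](rmorphXn pi) xE rmorph_sum; apply: eq_bigr => i _.
  by rewrite rmorphM rmorphXn /= (svalP (cid (pi_surj (P i)))).
pose Kc : closedFieldType := HB.pack K Kf (closed_field.Field_isAlgClosed.Build
  Kf closedK).
exists Kc, pi => x Mx; apply/eqP; exact: etrans (pi0 x) Mx.
Qed.

Definition Aint_ring := {x : algC | x \in Aint}.
HB.instance Definition _ := SubType.on Aint_ring.
HB.instance Definition _ := Choice.on Aint_ring.
HB.instance Definition _ := [SubChoice_isSubComNzRing of Aint_ring by <:].

Definition Aint_val (x : Aint_ring) : algC := val x.

Fact Aint_val_is_zmod_morphism : zmod_morphism Aint_val.
Proof. exact: rmorphB. Qed.

Fact Aint_val_is_monoid_morphism : monoid_morphism Aint_val.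
Proof. by split; [apply: rmorph1 | apply: rmorphM]. Qed.

HB.instance Definition _ :=
  GRing.isZmodMorphism.Build Aint_ring algC Aint_val Aint_val_is_zmod_morphism.
HB.instance Definition _ :=
  GRing.isMonoidMorphism.Build Aint_ring algC Aint_val
    Aint_val_is_monoid_morphism.

(** p is not a unit of [Aint], since 1/p is rational but not an integer. Roots of monic polynomials
    over [Aint] stay in [Aint], so the quotient by a maximal ideal containing p is algebraically
    closed. The reduction is set to 0 off [Aint]. *)
Lemma p_reduction_exists p : prime p ->
  exists F : closedFieldType, exists red : p_reduction p F, True.
Proof.
move=> pr_p; have nu_p (b : Aint_ring) : p%:R * b <> 1.
  move/(congr1 val); rewrite rmorphM rmorph_nat rmorph1 /= => pb1.
  have p_neq0 : (p%:R : algC) != 0 by rewrite pnatr_eq0 -lt0n prime_gt0.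
  have bE : val b = (p%:R)^-1 by apply: (mulfI p_neq0); rewrite pb1 divff.
  have : val b \in Num.int.
    by apply: Cint_rat_Aint (valP b); rewrite bE rpredV rpred_nat.
  move/norm_intr_ge1; rewrite bE => /(_ (invr_neq0 p_neq0)).
  rewrite normfV normr_nat invf_ge1 ?ltr0n ?prime_gt0 // lern1.
  by rewrite leqNgt prime_gt1.
have [M [Mp maxM]] := maximal_ideal_exists nu_p.
have [n P n_gt0|F [f f0]] := maximal_quotient_closed maxM.
  pose q : {poly algC} := 'X^n - \sum_(i < n) (val (P i))%:P * 'X^i.
  have size_q : size q = n.+1.
    rewrite size_polyDl size_polyXn // size_polyN ltnS.
    apply: leq_trans (size_sum _ _ _) _; apply/bigmax_leqP=> i _.
    rewrite mul_polyC; apply: leq_trans (size_scale_leq _ _) _.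
    by rewrite size_polyXn.
  have mon_q : q \is monic.
    rewrite monicE lead_coefE size_q /= coefB coefXn eqxx coef_sum big1 ?subr0
      // => i _.
    by rewrite coefCM coefXn gtn_eqF ?mulr0.
  have Aq : q \is a polyOver Aint.
    rewrite rpredB ?polyOverXn // rpred_sum // => i _.
    by rewrite rpredM ?polyOverXn // polyOverC (valP (P i)).
  have [x xE] := @GRing.solve_monicpoly algC n (fun i => val (P i)) n_gt0.
  have qx0 : root q x.
    rewrite /root !hornerE xE horner_sum; apply/eqP/eqP; rewrite subr_eq0;
      apply/eqP.
    by apply: eq_bigr => i _; rewrite !hornerE.
  have Ax := root_monic_over_Aint qx0 mon_q Aq.
  exists (Sub x Ax : Aint_ring); apply: val_inj.
  have vx : Aint_val (Sub x Ax) = x by [].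
  rewrite -![\val _]/(Aint_val _) rmorphXn rmorph_sum /= vx xE.
  by apply: eq_bigr => i _; rewrite rmorphM rmorphXn /= vx.
have charF : p \in [pchar F].
  by rewrite inE pr_p /= -(rmorph_nat f) f0.
pose r (a : algC) : F := if insub a is Some x then f x else 0.
have rE (x : Aint_ring) : r (val x) = f x by rewrite /r valK.
have r1 : r 1 = 1 by rewrite -(rmorph1 f) -rE.
have rD : {in Aint &, {morph r : a b / a + b}}.
  move=> a b Aa Ab.
  have := rE (Sub a Aa + Sub b Ab); rewrite [f _]rmorphD -!rE.
   rewrite -[\val (_ + _)]/(Aint_val _) rmorphD => E; exact: E.
have rM : {in Aint &, {morph r : a b / a * b}}.
  move=> a b Aa Ab.
  have := rE (Sub a Aa * Sub b Ab); rewrite [f _]rmorphM -!rE.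
  by rewrite -[\val (_ * _)]/(Aint_val _) rmorphM => E; exact: E.
by exists F, (PReduction charF r1 rD rM).
Qed.

(** * The bound *)

Lemma block_det_Cartan_ge (p : nat) (F : closedFieldType) (red : p_reduction p
  F)
    (gT : finGroupType) (G : {group gT}) (e : 'M[F]_(gcard G)) :
    block_idempotent e -> \det (Cartan_mx red e) != 0 ->
  (l_block red e * (k_block red e - l_block red e)).+1%:R
    <= \det (Cartan_mx red e).
Proof.
move=> blk nz_det; apply: connected_gram_det_ge => // [i j|J E EJ EJ'].
  by apply: intr_nat; case: (decompositionP blk i).
exact: (block_part_trivial blk EJ EJ').
Qed.

(** * The block of the trivial group, for which k = l = 1 and d = 0 *)

Section TrivialGroup.

Variables (p : nat) (F : closedFieldType) (red : p_reduction p F).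
Variable gT : finGroupType.
Local Notation e := (1%:M : 'M[F]_(gcard [1 gT]%G)).

Lemma trivial_block_idempotent : block_idempotent e.
Proof.
split.
- split; last by rewrite mulmx1.
  by apply/center_mxP; split=> [|A _]; rewrite ?envelop_mx1 // mulmx1 mul1mx.
- have i0 : 'I_(gcard [1 gT]%G) by exists 0%N; apply: cardG_gt0.
  by apply/eqP=> /matrixP/(_ i0 i0)/eqP; rewrite !mxE eqxx oner_eq0.
move=> f [_ ff] _; have: gcard [1 gT]%G = 1%N by apply: cards1.
move: (gcard _) f ff => n f ff n1; rewrite {n}n1 in f ff *.
rewrite (mx11_scalar f); move: ff; rewrite (mx11_scalar f) -scalar_mxM.
move/matrixP/(_ 0 0); rewrite !mxE eqxx !mulr1n => /eqP.
rewrite -subr_eq0 -{3}[f 0 0]mulr1 -mulrBr mulf_eq0 subr_eq0.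
by case/orP=> /eqP->; [left; rewrite raddf0 | right].
Qed.

Lemma trivial_block_defect : has_defect p e 0.
Proof.
exists [1 gT]%G; last exact: cards1.
split=> // [|H sH1 _]; last by apply/trivgP.
exists 1%:M; split=> [|x _|]; rewrite ?envelop_mx1 ?mulmx1 ?mul1mx //.
rewrite (eq_bigr (fun=> 1%:M)) => [|Dx]; last first.
  case/rcosetsP=> x /set1P-> ->; rewrite rcoset1 mulmx1.
  have /set1P-> : repr [1 gT] \in [1 gT] by apply: mem_repr (group1 _).
  by rewrite invg1 repr_mx1 mulmx1.
by rewrite sumr_const -[#|_|]/(#|[1 gT] : [1 gT]|) indexgg.
Qed.

Lemma card_classes_trivial : #|classes [1 gT]| = 1%N.
Proof.
apply/eqP; rewrite eqn_leq (leqNgt _ 1) (classes_gt1 [1 gT]%G) eqxx /=.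
exact: (classes_gt0 [1 gT]%G).
Qed.

Lemma trivial_k_block : k_block red e = 1%N.
Proof.
rewrite /k_block -card_classes_trivial -NirrE -[RHS]card_ord -[RHS]cardsT.
by apply: eq_card => i; rewrite !inE red_central_char1 eqxx.
Qed.

Lemma trivial_l_block : l_block red e = 1%N.
Proof.
apply/eqP; rewrite eqn_leq (l_block_gt0 (red := red) trivial_block_idempotent).
  rewrite andbT -card_classes_trivial -(dim_cfun [1 gT]%G).
  by rewrite /l_block -(eqP (IBr_block_free red e)) dimvS ?subvf.
by rewrite trivial_k_block.
Qed.

(** At 1, the character degree 1 is the decomposition number times the degree of the Brauer
    character, so both natural numbers are 1. *)
Lemma trivial_det_Cartan : \det (Cartan_mx red e) = 1.
Proof.
have blk := trivial_block_idempotent.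
have D1 i j : decomposition_mx red e i j = 1.
  have [Dnat DE] := decompositionP blk i.
  have /mem_IBr_block[n [rG [_ _ [_ aff]]]] : (IBr_block red e)`_j \in
    IBr_block red e by apply: mem_nth.
  have R1 := p_regular1 p [1 gT]%G.
  have [s [/allP s1 _ phi1]] := aff 1%g R1.
  have eq0 (j' : 'I_(l_block red e)) : j' = j.
    by apply: val_inj; case: j j' {phi1 aff} => [a lta] [b ltb] /=; move: lta
      ltb; rewrite trivial_l_block; case: a b => [|a] [|b].
  have /cfunP/(_ 1%g) := DE; rewrite sum_cfunE (bigD1 j) //= big1 => [|j'
    /eqP[]//].
  rewrite addr0 !cfunE cfuniE ?p_regular_normal // R1 mul1r phi1 => D1E.
  have sE : \sum_(z <- s) z = (size s)%:R.
    rewrite (eq_big_seq (fun=> 1)) ?big_const_seq ?count_predT ?iter_addr_0 //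
      => z /s1.
    by rewrite order1 => /unity_rootP; rewrite expr1.
  have lin1 : 'chi[[1 gT]%G]_(enum_val i) 1%g = 1.
    apply/eqP; have : 'chi[[1 gT]%G]_(enum_val i) \is a linear_char.
      by apply/char_abelianP; rewrite abelian1.
    by case/andP.
  have [q qE] := natrP (Dnat j).
  move: D1E; rewrite lin1 sE qE -natrM => /eqP; rewrite eq_sym pnatr_eq1
    muln_eq1.
  by case/andP=> /eqP->.
rewrite /Cartan_mx; move: (decomposition_mx red e) D1.
rewrite trivial_k_block trivial_l_block => Q Q1.
by rewrite det_mx11 mxE big_ord1 mxE !Q1 mulr1.
Qed.

End TrivialGroup.

Theorem theorem1 (p : nat) (p_prime : prime p) :
  (forall (F : closedFieldType) (red : p_reduction p F)
      (gT : finGroupType) (G : {group gT}) (e : 'M[F]_(gcard G)) (d : nat),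
    block_idempotent e ->
    has_defect p e d ->
    (l_block red e <= 4)%N ->
    \det (Cartan_mx red e) = (p ^ d)%:R ->
    (k_block red e)%:R
      <= ((p ^ d)%:R - 1) / (l_block red e)%:R + (l_block red e)%:R :> rat)
  /\
  (exists (F : closedFieldType) (red : p_reduction p F)
      (gT : finGroupType) (G : {group gT}) (e : 'M[F]_(gcard G)) (d : nat),
    block_idempotent e /\
    has_defect p e d /\
    (l_block red e <= 4)%N /\
    \det (Cartan_mx red e) = (p ^ d)%:R /\
    (k_block red e)%:R
      = ((p ^ d)%:R - 1) / (l_block red e)%:R + (l_block red e)%:R :> rat).
Proof.
split=> [F red gT G e d blk _ _ detC|].
  have pd_gt0 : (0 < p ^ d)%N by rewrite expn_gt0 prime_gt0.
  have := block_det_Cartan_ge (red := red) blk.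
  rewrite detC pnatr_eq0 -lt0n pd_gt0 ler_nat => /(_ isT).
  have := l_block_gt0 (red := red) blk.
  move: (k_block _ _) (l_block _ _) => k l lt0 le_pd.
  (* For l = 0, division by zero yields 0, but then k = 0 by [l_block_gt0]. *)
  have [l0|l_gt0] := posnP l.
    have -> : k = 0%N by apply/eqP; rewrite -leqn0 leqNgt; apply/negP=> /lt0;
      rewrite l0.
    by rewrite l0 invr0 mulr0 addr0.
  have lQ : 0 < l%:R :> rat by rewrite ltr0n.
  rewrite -lerBlDr ler_pdivlMr // lerBrDr.
  (* Natural subtraction truncates, so only this inequality is claimed; it points the right way. *)
  have : (k%:R - l%:R : rat) <= (k - l)%:R.
    by rewrite lerBlDr -natrD ler_nat addnC -leq_subLR.
  rewrite -(ler_pM2r lQ) => le_kl; rewrite (le_trans (lerD le_kl (lexx 1))) //.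
  by rewrite -natrM -[X in _ + X]/(1%:R) -natrD ler_nat addn1 mulnC.
have [F [red _]] := p_reduction_exists p_prime.
(* Equality reads 1 = (p^0 - 1) / 1 + 1; [{perm 'I_1}] merely supplies an ambient finite group. *)
exists F, red, {perm 'I_1}, [1 {perm 'I_1}]%G, 1%:M, 0%N.
rewrite trivial_det_Cartan trivial_l_block trivial_k_block.
split; first exact: trivial_block_idempotent.
split; first exact: trivial_block_defect.
by rewrite expn0 subrr mul0r add0r.
Qed.
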